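(* Let $T>0$, let $v:\mathbb{R}^N\to\mathbb{R}$ be Lipschitz continuous and let $u_T:\mathbb{R}^N\to\mathbb{R}$ be bounded and Lipschitz continuous. Then the value function $u^\varepsilon$ of the eikonal game converges locally uniformly on $(0,T]\times\mathbb{R}^N$, as $\varepsilon\to0$, towards the unique viscosity solution of $$-\partial_tu-v(x)|Du|=0\quad\text{in }(0,T)\times\mathbb{R}^N,\qquad u(T,x)=u_T(x).$$
   Context: $B_r(x)$ is the (closed, by convention) ball of radius $r$ centered at $x$; $a_+=\max(0,a)$, $a_-=\max(0,-a)$. Cut-off: $C_\varepsilon(r)=(r\vee\varepsilon^{3/2})\wedge\varepsilon^{1/2}$, where $a\vee b=\max(a,b)$, $a\wedge b=\min(a,b)$. For $x\in\mathbb{R}^N$ let $E^\pm(x)=B_\varepsilon(x)\cap\{\pm v>0\}$ if this set is non-empty, and $E^\pm(x)=\{x\}$ otherwise. The value function of the eikonal game is defined by $u^\varepsilon(t,x)=u_T(x)$ if $t\ge T$ and, for $0<t<T$, recursively by $$u^\varepsilon(t,x)=\sup_{x_P\in E^+(x)}\ \inf_{x_C\in E^-(x_P)}u^\varepsilon(t_C,x_C),$$ where $t_P=t+C_\varepsilon[\varepsilon(v_+(x_P))^{-1}]$ if $B_\varepsilon(x)\cap\{v>0\}\ne\varnothing$ and $t_P=t+\varepsilon^2$ otherwise; $t_C=t_P+C_\varepsilon[\varepsilon(v_-(x_C))^{-1}]$ if $B_\varepsilon(x_P)\cap\{v<0\}\neq\varnothing$ and $t_C=t_P+\varepsilon^2$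 otherwise. Viscosity solutions: an upper (resp. lower) semi-continuous $u:(0,T)\times\mathbb{R}^N\to\mathbb{R}$ is a sub-solution (resp. super-solution) of $-\partial_tu-v(x)|Du|=0$ if for every $C^2$ test function $\phi$ such that $u-\phi$ has a local maximum (resp. minimum) at $(t,x)\in(0,T)\times\mathbb{R}^N$, $-\partial_t\phi(t,x)-v(x)|D\phi(t,x)|\le0$ (resp. $\ge0$). A solution is both a sub- and a super-solution. *)

(* Defs.v *)
From HB Require Import structures.
From mathcomp Require Import all_boot all_order all_algebra.
From mathcomp Require Import all_classical all_reals all_analysis.
Set Implicit Arguments.
Unset Strict Implicit.
Unset Printing Implicit Defensive.
Import Order.TTheory GRing.Theory Num.Theory.
Import numFieldNormedType.Exports.
Local Open Scope classical_set_scope.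
Local Open Scope ring_scope.

Section Euclidean.
Context {R : realType} {N : nat}.

(* The canonical norm of ['rV[R]_N] is the sup norm, whereas balls and |Du| are
   Euclidean. *)
Definition enorm (x : 'rV[R]_N) : R := Num.sqrt (\sum_(i < N) x 0 i ^+ 2).

Definition eball (r : R) (x : 'rV[R]_N) : set 'rV[R]_N :=
  [set y | enorm (y - x) <= r].

End Euclidean.

Section Game.
Context {R : realType} {N : nat}.
Implicit Types (T e r t : R) (w v uT : 'rV[R]_N -> R) (x y : 'rV[R]_N).

Definition cutoff e r : R :=
  Num.min (Num.max r (e `^ (3 / 2))) (e `^ (1 / 2)).

(* The definitions with parameter [w] serve both players: [w] is [v] for Paul
   and [\- v] for Carol, so that {w > 0} is {v > 0}, resp. {v < 0}, and
   max(0, w) is v_+, resp. v_-. *)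
Definition can_move w e x : Prop := eball e x `&` [set y | 0 < w y] !=set0.

Definition moves w e x : set 'rV[R]_N :=
  if `[< can_move w e x >] then eball e x `&` [set y | 0 < w y] else [set x].

Definition delay w e x y : R :=
  if `[< can_move w e x >] then cutoff e (e * (Num.max 0 (w y))^-1)
  else e ^+ 2.

Definition game_step v e (u : R * 'rV[R]_N -> R) t x : R :=
  sup [set inf [set u (t + delay v e x xP + delay (\- v) e xP xC, xC)
               | xC in moves (\- v) e xP]
      | xP in moves v e x].

(* [u] is unconstrained at times t <= 0.  Existence, and uniqueness at positive
   times, are proved below. *)
Definition is_game_value T v uT e (u : R * 'rV[R]_N -> R) : Prop :=
  (forall t x, T <= t -> u (t, x) = uT x) /\
  (forall t x, 0 < t < T -> u (t, x) = game_step v e u t x).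

Let tick e : R :=
  Num.min (e ^+ 2) (Num.min (e `^ (3 / 2)) (e `^ (1 / 2))).

Let tick_gt0 e : 0 < e -> 0 < tick e.
Proof. by move=> e0; rewrite !lt_min exprn_gt0 ?powR_gt0. Qed.

Let tick_delay w e x y : tick e <= delay w e x y.
Proof.
rewrite /tick /delay; case: ifP => _; last by rewrite ge_min lexx.
by rewrite ge_min; apply/orP; right; rewrite /cutoff le_min !ge_min le_max !lexx
  ?orbT.
Qed.

Let eq_game_step v e u1 u2 t x : 0 < e ->
  (forall t' y, t + tick e <= t' -> u1 (t', y) = u2 (t', y)) ->
  game_step v e u1 t x = game_step v e u2 t x.
Proof.
move=> e0 u12; rewrite /game_step; congr sup; apply: eq_imagel => xP _.
congr inf; apply: eq_imagel => xC _; apply: u12.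
by rewrite -addrA lerD2l (le_trans (tick_delay v e x xP))// lerDl
  (le_trans _ (tick_delay _ _ _ _))// ltW// tick_gt0.
Qed.

Lemma game_value_unique T v uT e u1 u2 : 0 < e ->
  is_game_value T v uT e u1 -> is_game_value T v uT e u2 ->
  forall t x, 0 < t -> u1 (t, x) = u2 (t, x).
Proof.
move=> e0 [u1T u1S] [u2T u2S] t x t0.
have [n] : exists n : nat, T - t <= n%:R * tick e.
  exists (Num.bound `|(T - t) / tick e|).
  by rewrite -ler_pdivrMr ?tick_gt0// (le_trans (ler_norm _))// ltW//
    archi_boundP.
elim: n t x t0 => [|n IH] t x t0 Tt; have [Tlet|tltT] := leP T t.
- by rewrite u1T ?u2T.
- by move: Tt; rewrite mul0r subr_le0 leNgt tltT.
- by rewrite u1T ?u2T.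
- rewrite u1S ?u2S ?t0//; apply: eq_game_step => // t' y tt'.
  have := tick_gt0 e0 => k0; apply: IH.
    by rewrite (lt_le_trans _ tt')// addr_gt0.
  rewrite lerBlDr (le_trans _ (lerD (lexx _) tt'))//.
  by move: Tt; rewrite lerBlDr -addn1 natrD mulrDl mul1r -addrA (addrC t).
Qed.

Let approx T v uT e := fix approx n (p : R * 'rV[R]_N) : R :=
  if T <= p.1 then uT p.2 else
  if n is n'.+1 then game_step v e (approx n') p.1 p.2 else 0.

Let approx_stable T v uT e n k t x : 0 < e -> T - t <= n%:R * tick e ->
  (n <= k)%N -> approx T v uT e k (t, x) = approx T v uT e n (t, x).
Proof.
move=> e0; elim: n k t x => [|n IH] [|k] t x Tt nk //=.
  by move: Tt; rewrite mul0r subr_le0 => ->.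
case: ifP => // _; apply: eq_game_step => // t' y tt'; apply: IH => //.
rewrite lerBlDr (le_trans _ (lerD (lexx _) tt'))//.
by move: Tt; rewrite lerBlDr -addn1 natrD mulrDl mul1r -addrA (addrC t).
Qed.

Lemma game_value_exists T v uT e : 0 < e ->
  exists u, is_game_value T v uT e u.
Proof.
move=> e0; pose n t := Num.bound `|(T - t) / tick e|.
have nP t : T - t <= (n t)%:R * tick e.
  by rewrite -ler_pdivrMr ?tick_gt0// (le_trans (ler_norm _))// ltW//
    archi_boundP.
exists (fun p => approx T v uT e (n p.1) p); split => [t x Tt|t x /andP[_ tT]].
  by move=> /=; case: (n t) => [|m] /=; rewrite Tt.
apply: (@eq_trans _ _ (approx T v uT e (n t).+1 (t, x))).
  by apply/esym; exact: approx_stable.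
rewrite /= leNgt tT /=; apply: eq_game_step => // t' y tt' /=.
have Tt' : T - t' <= (n t)%:R * tick e.
  apply: le_trans (nP t); rewrite lerB// (le_trans _ tt')// lerDl ltW//.
  exact: tick_gt0.
have [nn|/ltnW nn] := leqP (n t') (n t).
  exact: approx_stable e0 (nP t') nn.
by apply/esym; exact: approx_stable e0 Tt' nn.
Qed.

End Game.

Section Viscosity.
Context {R : realType} {N : nat}.
Implicit Types (T : R) (v uT : 'rV[R]_N -> R) (u phi : R * 'rV[R]_N -> R).
Implicit Types (p q d : R * 'rV[R]_N).

Definition cylinder T : set (R * 'rV[R]_N) := [set p | 0 < p.1 < T].
Definition cylinderT T : set (R * 'rV[R]_N) := [set p | 0 < p.1 <= T].

(* For open [A] this is C^2 on [A]; [d], [d'] range over all directions of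
   R x R^N, hence over the coordinate ones. *)
Definition C2_on (A : set (R * 'rV[R]_N)) phi : Prop :=
  forall p, A p ->
    differentiable phi p /\
    forall d, differentiable ('D_d phi) p /\
      forall d', {for p, continuous ('D_d' ('D_d phi))}.

Definition dt phi p : R := 'D_(1, 0) phi p.
Definition grad phi p : 'rV[R]_N := \row_(i < N) 'D_(0, delta_mx 0 i) phi p.

Definition usc_on (A : set (R * 'rV[R]_N)) u : Prop :=
  forall p, A p -> forall a, u p < a -> \forall q \near within A (nbhs p), u q < a.
Definition lsc_on (A : set (R * 'rV[R]_N)) u : Prop :=
  forall p, A p -> forall a, a < u p -> \forall q \near within A (nbhs p), a < u q.

Definition subsolution T v u : Prop :=
  usc_on (cylinder T) u /\
  forall phi, C2_on (cylinder T) phi -> forall p, cylinder T p ->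
    (\forall q \near p, u q - phi q <= u p - phi p) ->
    - dt phi p - v p.2 * enorm (grad phi p) <= 0.

Definition supersolution T v u : Prop :=
  lsc_on (cylinder T) u /\
  forall phi, C2_on (cylinder T) phi -> forall p, cylinder T p ->
    (\forall q \near p, u p - phi p <= u q - phi q) ->
    0 <= - dt phi p - v p.2 * enorm (grad phi p).

(* The terminal value is attained continuously: [u] is continuous up to time T.
   Without this, the value at T would be unrelated to the equation. *)
Definition viscosity_solution T v uT u : Prop :=
  [/\ subsolution T v u, supersolution T v u,
      {within cylinderT T, continuous u} & forall x, u (T, x) = uT x].

End Viscosity.

(* Main.v *)
Require Import Defs.
From HB Require Import structures.
From mathcomp Require Import all_boot all_order all_algebra.
From mathcomp Require Import all_classical all_reals all_analysis.
From mathcomp Require Import ring lra.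
Set Implicit Arguments.
Unset Strict Implicit.
Unset Printing Implicit Defensive.
Import Order.TTheory GRing.Theory Num.Theory.
Import numFieldNormedType.Exports.
Local Open Scope classical_set_scope.
Local Open Scope ring_scope.

(** Two facts carry the proof: the half-relaxed limits of the value functions
    are a sub- and a supersolution that attain the terminal value, and a
    comparison principle holds for semicontinuous functions.

    Relaxed limits. Let [U] and [V] be the upper and the lower half-relaxed
    limits of the value functions as [e] tends to zero ([upper_limit],
    [lower_limit]); clearly [V <= U]. If a test function [phi] touches [U] from
    above at [p], then for arbitrarily small [e] the function [phi] plus a
    quadratic penalty touches the value function from above near [p], up to an
    error [e ^ 3] ([relaxed_sup_test]). If the inequality of subsolutions failed
    at [p], Carol could answer every move of Paul near [p] so that [phi]
    decreases by a fixed multiple of the duration of the round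
    ([consistency_le]); as a round lasts at least [e ^ 2], this contradicts one
    round of the game. Two estimates give this answer. A player moves at most at
    the speed [|v|] of the equation, up to an error that vanishes with [e]
    ([move_speed], [rounds_near]); this settles the case of a nonnegative [v].
    Where [v] is negative, Paul is stuck, and Carol moves at about the speed
    [|v|] in the direction of steepest descent ([free_player_near]). The argument
    for [V] exchanges the roles of the players ([consistency_ge]). At the
    terminal time both limits equal [uT], because [v] grows at most linearly and
    plays that start close to [(T, x0)] therefore end close to [x0]
    ([terminal_convergence]).

    Comparison. Let [U] be a subsolution and [V] a supersolution with [U <= V]
    at time [T]; no growth condition is available, but the speed grows at most
    linearly. Hence a suitable polynomial [cone] has sublevel sets that shrink
    backwards in time faster than the characteristics move, and its powers are
    strict supersolutions ([barrier_strict]). Subtracting a small multiple of a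
    high power of [cone] makes [U - V] negative on the boundary of a
    sublevel set but not at a given point where [U > V], and doubling the
    variables inside this compact set ([doubling_of_variables]) gives a
    contradiction ([comparison]). All test functions involved are polynomials,
    hence of class C^2 ([poly_fun_C2]).

    Comparison yields [U <= V], so that [U = V] is a continuous viscosity
    solution; comparison again gives its uniqueness, and the equality of the two
    relaxed limits gives the locally uniform convergence
    ([uniform_convergence]). *)

(** * The Euclidean norm *)

Section EuclideanNorm.
Context {R : realType} {N : nat}.
Implicit Types x y z : 'rV[R]_N.

Definition dot x y : R := \sum_(i < N) x 0 i * y 0 i.

Lemma dotDl x y z : dot (x + y) z = dot x z + dot y z.
Proof. by rewrite -big_split; apply: eq_bigr => i _; rewrite mxE mulrDl. Qed.

Lemma dotC x y : dot x y = dot y x.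
Proof. by apply: eq_bigr => i _; rewrite mulrC. Qed.

Lemma dotZl a x y : dot (a *: x) y = a * dot x y.
Proof. by rewrite mulr_sumr; apply: eq_bigr => i _; rewrite mxE mulrA. Qed.

Lemma dotDr x y z : dot x (y + z) = dot x y + dot x z.
Proof. by rewrite dotC dotDl !(dotC x). Qed.

Lemma dotZr a x y : dot x (a *: y) = a * dot x y.
Proof. by rewrite dotC dotZl dotC. Qed.

Lemma dotNl x y : dot (- x) y = - dot x y.
Proof. by rewrite -scaleN1r dotZl mulN1r. Qed.

Lemma dotNr x y : dot x (- y) = - dot x y.
Proof. by rewrite dotC dotNl dotC. Qed.

Lemma dotxx_ge0 x : 0 <= dot x x.
Proof. by apply: sumr_ge0 => i _; rewrite -expr2 sqr_ge0. Qed.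

Lemma enormE x : enorm x = Num.sqrt (dot x x).
Proof. by congr Num.sqrt; apply: eq_bigr => i _; rewrite expr2. Qed.

Lemma enorm_ge0 x : 0 <= enorm x.
Proof. exact: sqrtr_ge0. Qed.

Lemma sqr_enorm x : enorm x ^+ 2 = dot x x.
Proof. by rewrite enormE sqr_sqrtr ?dotxx_ge0. Qed.

Lemma le_enorm x a : 0 <= a -> dot x x <= a ^+ 2 -> enorm x <= a.
Proof.
by move=> a0 xa; rewrite -(@ler_pXn2r _ 2) ?nnegrE ?enorm_ge0// sqr_enorm.
Qed.

Lemma enormZ a x : enorm (a *: x) = `|a| * enorm x.
Proof.
by rewrite !enormE dotZl dotZr mulrA -expr2 sqrtrM ?sqr_ge0// sqrtr_sqr.
Qed.

Lemma enormN x : enorm (- x) = enorm x.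
Proof. by rewrite -scaleN1r enormZ normrN1 mul1r. Qed.

Lemma enorm0 : enorm (0 : 'rV[R]_N) = 0.
Proof. by rewrite -(scale0r 0) enormZ normr0 mul0r. Qed.

Lemma normr_le_enorm x : `|x| <= enorm x.
Proof.
rewrite /Num.Def.normr /= mx_normrE; apply/bigmax_leP; split=> [|[i j] _ /=].
  exact: enorm_ge0.
rewrite ord1 -sqrtr_sqr enormE ler_wsqrtr// /dot (bigD1 j)//= expr2 lerDl.
by apply: sumr_ge0 => k _; rewrite -expr2 sqr_ge0.
Qed.

Lemma coord_le_normr x i : `|x 0 i| <= `|x|.
Proof.
rewrite [leRHS]/Num.Def.normr /= mx_normrE.
by apply/bigmax_geP; right => /=; exists (0, i).
Qed.

Lemma enorm_le_normr x : enorm x <= N%:R * `|x|.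
Proof.
apply: le_enorm; first by rewrite mulr_ge0.
apply: (@le_trans _ _ (\sum_(i < N) `|x| ^+ 2)).
  apply: ler_sum => i _; rewrite -expr2 -real_normK ?num_real//.
  by rewrite lerXn2r ?nnegrE// coord_le_normr.
rewrite sumr_const card_ord exprMn -[leLHS]mulr_natl ler_wpM2r ?sqr_ge0//.
by rewrite -natrX ler_nat; case: (N) => // n; rewrite leq_pmulr.
Qed.

Lemma enorm_eq0 x : enorm x = 0 -> x = 0.
Proof.
by move=> x0; apply/normr0_eq0/le_anti; rewrite normr_ge0 -x0 normr_le_enorm.
Qed.

Lemma cauchy_schwarz x y : dot x y <= enorm x * enorm y.
Proof.
have [x0|x0] := eqVneq (enorm x) 0.
  by rewrite x0 (enorm_eq0 x0) -(scale0r 0) dotZl !mul0r.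
have [y0|y0] := eqVneq (enorm y) 0.
  by rewrite y0 (enorm_eq0 y0) -(scale0r 0) dotZr mul0r mulr0.
have a0 : 0 < enorm x by rewrite lt_def x0 enorm_ge0.
have b0 : 0 < enorm y by rewrite lt_def y0 enorm_ge0.
have := dotxx_ge0 (enorm y *: x - enorm x *: y).
rewrite !(dotDl, dotDr, dotNl, dotNr, dotZl, dotZr) (dotC y x) -!sqr_enorm.
set a := enorm x in a0 *; set b := enorm y in b0 *; set d := dot x y => H.
have ab : 0 < a * b by rewrite mulr_gt0.
have {}H : 0 <= 2 * (a * b) * (a * b - d) by move: H; lra.
by move: H; rewrite pmulr_rge0 ?subr_ge0// mulr_gt0.
Qed.

Lemma cauchy_schwarzN x y : - (enorm x * enorm y) <= dot x y.
Proof. by rewrite lerNl -dotNl (le_trans (cauchy_schwarz _ _))// enormN. Qed.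

Lemma ler_enormD x y : enorm (x + y) <= enorm x + enorm y.
Proof.
apply: le_enorm; first by rewrite addr_ge0 ?enorm_ge0.
rewrite !(dotDl, dotDr) (dotC y x) -!sqr_enorm.
by have := cauchy_schwarz x y; lra.
Qed.

Lemma enorm_distC x y : enorm (x - y) = enorm (y - x).
Proof. by rewrite -enormN opprB. Qed.

Lemma enorm_dist_triangle y x z :
  enorm (x - z) <= enorm (x - y) + enorm (y - z).
Proof. by rewrite (le_trans _ (ler_enormD _ _))// addrA subrK. Qed.

(** A vector of Euclidean length at most one that realizes the equality case
    of the Cauchy-Schwarz inequality against [x]; it is zero if [x] is. *)
Lemma exists_direction x : exists2 e, enorm e <= 1 & dot x e = enorm x.
Proof.
have [x0|x0] := eqVneq (enorm x) 0.
  by exists 0; rewrite ?enorm0// x0 -(scale0r 0) dotZr mul0r.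
exists ((enorm x)^-1 *: x).
  by rewrite enormZ ger0_norm ?invr_ge0 ?enorm_ge0// mulVf.
by rewrite dotZr -sqr_enorm expr2 mulrA mulVf// mul1r.
Qed.

End EuclideanNorm.

(** * Rounds and values of the game *)

Section Rounds.
Context {R : realType} {N : nat}.
Implicit Types (w v uT : 'rV[R]_N -> R) (x y z : 'rV[R]_N) (e : R).

(** Time taken by a round in which Paul moves from [x] to [xP] and Carol from
    [xP] to [xC]. *)
Definition duration v e x xP xC : R :=
  delay v e x xP + delay (\- v) e xP xC.

Lemma powR_half_sqr (e : R) : 0 < e -> (e `^ (1 / 2)) ^+ 2 = e.
Proof.
by move=> e0; rewrite -powR_mulrn ?powR_ge0// -powRrM mul1r mulVf// powRr1// ltW.
Qed.

Lemma powR_half_cube (e : R) : 0 < e -> e `^ (3 / 2) = (e `^ (1 / 2)) ^+ 3.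
Proof.
move=> e0; rewrite -powR_mulrn ?powR_ge0// -powRrM; congr (_ `^ _).
by rewrite mul1r mulrC.
Qed.

Lemma powR_half_gt0 (e : R) : 0 < e -> 0 < e `^ (1 / 2).
Proof. exact: powR_gt0. Qed.

Lemma powR_half_le (e a : R) : 0 < e -> 0 <= a -> e <= a ^+ 2 ->
  e `^ (1 / 2) <= a.
Proof.
move=> e0 a0 ea; rewrite -(@ler_pXn2r _ 2) ?nnegrE ?powR_ge0//.
by rewrite powR_half_sqr.
Qed.

Lemma moves_neq0 w e x : moves w e x !=set0.
Proof. by rewrite /moves; case: asboolP => // _; exists x. Qed.

Lemma moves_eball w e x y : 0 < e -> moves w e x y -> enorm (y - x) <= e.
Proof.
move=> e0; rewrite /moves; case: asboolP => [_ []//|_ ->].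
by rewrite subrr enorm0 ltW.
Qed.

Lemma delay_ge w e x y : 0 < e <= 1 -> e ^+ 2 <= delay w e x y.
Proof.
move=> /andP[e0 e1]; rewrite /delay; case: ifP => // _.
have s0 := powR_half_gt0 e0.
have s1 : e `^ (1 / 2) <= 1 by apply: powR_half_le => //; rewrite expr1n.
rewrite /cutoff powR_half_cube// -{1}(powR_half_sqr e0) -exprM.
rewrite le_min le_max -(expr1 (e `^ (1 / 2))) -!exprM.
by rewrite !ler_wiXn2l ?orbT//; rewrite ltW.
Qed.

Lemma delay_gt0 w e x y : 0 < e <= 1 -> 0 < delay w e x y.
Proof.
by move=> e01; rewrite (lt_le_trans _ (delay_ge _ _ _ e01))// exprn_gt0//;
  case/andP: e01.
Qed.

Lemma delay_le w e x y : 0 < e <= 1 -> delay w e x y <= e `^ (1 / 2).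
Proof.
move=> /andP[e0 e1]; rewrite /delay; case: ifP => _.
  by rewrite /cutoff ge_min lexx orbT.
have s0 := powR_half_gt0 e0.
have s1 : e `^ (1 / 2) <= 1 by apply: powR_half_le => //; rewrite expr1n.
rewrite -{1}(powR_half_sqr e0) -exprM -[leRHS]expr1.
by rewrite ler_wiXn2l// ltW.
Qed.

(** The cut-off never makes a player faster than the larger of the local speed
    and [e ^ (1/2)]. *)
Lemma move_speed w e x y : 0 < e <= 1 -> moves w e x y ->
  enorm (y - x) <= delay w e x y * Num.max (w y) (e `^ (1 / 2)).
Proof.
move=> e01 mxy; have /andP[e0 e1] := e01; have s0 := powR_half_gt0 e0.
have m0 : 0 < Num.max (w y) (e `^ (1 / 2)) by rewrite lt_max s0 orbT.
move: mxy m0; rewrite /moves /delay; case: asboolP => [_ [exy wy]|_ ->] m0; last first.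
  by rewrite subrr enorm0 mulr_ge0 ?(ltW m0)// sqr_ge0.
rewrite (max_idPr (ltW wy)); apply: (le_trans exy).
rewrite -ler_pdivrMr// /cutoff le_min le_max; apply/andP; split.
  apply/orP; left; rewrite ler_pM2l// lef_pV2 ?posrE//.
  by rewrite le_max lexx.
rewrite ler_pdivrMr// -{1}(powR_half_sqr e0) expr2 ler_pM2l//.
by rewrite le_max lexx orbT.
Qed.

(** A player who sees no favourable point stays put. *)
Lemma moves_stuck w e x y : 0 < e -> (forall z, enorm (z - x) <= e -> w z <= 0) ->
  moves w e x y -> y = x.
Proof.
move=> e0 wx; rewrite /moves; case: asboolP => [[z []]|_]; last by [].
by move=> /wx wz /=; rewrite ltNge wz.
Qed.

Lemma delay_stuck w e x y : (forall z, enorm (z - x) <= e -> w z <= 0) ->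
  delay w e x y = e ^+ 2.
Proof.
move=> wx; rewrite /delay; case: asboolP => // -[z []].
by move=> /wx wz /=; rewrite ltNge wz.
Qed.

Lemma moves_free w e x y : enorm (y - x) <= e -> 0 < w y -> moves w e x y.
Proof. by move=> yx wy; rewrite /moves; case: asboolP => // -[]; exists y. Qed.

(** In the range of speeds that the cut-off leaves unchanged, the delay is the
    time needed to travel the distance [e] at speed [w y]. *)
Lemma delay_free w e x y : 0 < e -> enorm (y - x) <= e ->
  e `^ (1 / 2) <= w y -> w y * e `^ (1 / 2) <= 1 -> delay w e x y * w y = e.
Proof.
move=> e0 yx w1 w2; have s0 := powR_half_gt0 e0.
have w0 : 0 < w y := lt_le_trans s0 w1.
rewrite /delay; case: asboolP => [_|[]]; last by exists y.
rewrite (max_idPr (ltW w0)) /cutoff (@max_l _ _ (e / w y)); last first.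
  rewrite ler_pdivlMr// powR_half_cube// -{2}(powR_half_sqr e0) exprSr -mulrA.
  by rewrite ler_piMr ?sqr_ge0// mulrC.
rewrite min_l ?divfK ?gt_eqF// ler_pdivrMr// -{1}(powR_half_sqr e0) expr2.
by rewrite ler_pM2l.
Qed.

Lemma duration_gt0 v e x xP xC : 0 < e <= 1 -> 0 < duration v e x xP xC.
Proof. by move=> e01; rewrite addr_gt0// delay_gt0. Qed.

Lemma duration_ge v e x xP xC : 0 < e <= 1 -> e ^+ 2 <= duration v e x xP xC.
Proof.
by move=> e01; rewrite (le_trans (delay_ge v x xP e01))// lerDl ltW// delay_gt0.
Qed.

Lemma duration_le v e x xP xC : 0 < e <= 1 ->
  duration v e x xP xC <= 2 * e `^ (1 / 2).
Proof. by move=> e01; rewrite mulr_natl mulr2n lerD// delay_le. Qed.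

Lemma round_eball v e x xP xC : 0 < e -> moves v e x xP ->
  moves (\- v) e xP xC -> enorm (xC - x) <= 2 * e.
Proof.
move=> e0 /(moves_eball e0) mP /(moves_eball e0) mC.
by rewrite mulr_natl mulr2n (le_trans (enorm_dist_triangle xP _ _))// lerD.
Qed.

(** A bound [K] on the speeds at the two arrival points bounds the mean speed of
    the whole round, whoever moves. *)
Lemma round_speed v e x xP xC K : 0 < e <= 1 -> moves v e x xP ->
  moves (\- v) e xP xC -> `|v xP| <= K -> `|v xC| <= K -> e `^ (1 / 2) <= K ->
  enorm (xC - x) <= K * duration v e x xP xC.
Proof.
move=> e01 mP mC vP vC sK.
rewrite (le_trans (enorm_dist_triangle xP _ _))// mulrC /duration mulrDl addrC.
apply: lerD.
  apply: (le_trans (move_speed e01 mP)).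
  rewrite ler_wpM2l ?(ltW (delay_gt0 _ _ _ e01))// ge_max sK andbT.
  exact: le_trans (ler_norm _) vP.
apply: (le_trans (move_speed e01 mC)).
rewrite ler_wpM2l ?(ltW (delay_gt0 _ _ _ e01))// ge_max sK andbT.
by apply: le_trans (ler_norm _) _; rewrite normrN.
Qed.

End Rounds.

Section Values.
Context {R : realType} {N : nat} (T : R) (v uT : 'rV[R]_N -> R) (e M : R).
Variable u : R * 'rV[R]_N -> R.
Hypotheses (e01 : 0 < e <= 1) (uval : is_game_value T v uT e u).
Hypothesis uTM : forall x, `|uT x| <= M.
Implicit Types (x y : 'rV[R]_N) (t : R).

Let e0 : 0 < e. Proof. by case/andP: e01. Qed.

(** Backward induction in time: a round lasts at least [e ^ 2]. *)
Lemma time_ind (P : R -> 'rV[R]_N -> Prop) :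
  (forall t x, T <= t -> P t x) ->
  (forall t x, 0 < t < T -> (forall t' y, t + e ^+ 2 <= t' -> P t' y) -> P t x) ->
  forall t x, 0 < t -> P t x.
Proof.
move=> PT PS t x t0.
have ee : 0 < e ^+ 2 by rewrite exprn_gt0.
have [n] : exists n : nat, T - t <= n%:R * e ^+ 2.
  exists (Num.bound `|(T - t) / e ^+ 2|).
  by rewrite -ler_pdivrMr// (le_trans (ler_norm _))// ltW// archi_boundP.
elim: n t x t0 => [|n IH] t x t0 Tt; have [Tlet|tltT] := leP T t.
- exact: PT.
- by move: Tt; rewrite mul0r subr_le0 leNgt tltT.
- exact: PT.
- apply: PS; rewrite ?t0// => t' y tt'; apply: IH.
    by rewrite (lt_le_trans _ tt')// addr_gt0.
  by move: Tt; rewrite -natr1 mulrDl mul1r; lra.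
Qed.

Lemma game_value_bounded t x : 0 < t -> `|u (t, x)| <= M.
Proof.
have [uE uS] := uval.
apply: (time_ind (P := fun t x => `|u (t, x)| <= M)) => {t x} [t x Tt|t x t0T IH].
  by rewrite uE.
have uM xP xC : `|u (t + delay v e x xP + delay (\- v) e xP xC, xC)| <= M.
  by apply: IH; rewrite -addrA lerD2l duration_ge.
rewrite uS// /game_step ler_norml.
have infM xP : - M <= inf [set u (t + delay v e x xP + delay (\- v) e xP xC, xC)
     | xC in moves (\- v) e xP] <= M.
  have [xC mC] := moves_neq0 (\- v) e xP.
  apply/andP; split.
    apply: lb_le_inf; first by eexists; exists xC.
    by move=> _ [y _ <-]; have := uM xP y; rewrite ler_norml => /andP[].
  apply: le_trans (_ : u (t + delay v e x xP + delay (\- v) e xP xC, xC) <= M).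
    apply: ge_inf; last by exists xC.
    by exists (- M) => _ [y _ <-]; have := uM xP y; rewrite ler_norml => /andP[].
  by have := uM xP xC; rewrite ler_norml => /andP[].
have [xP mP] := moves_neq0 v e x.
apply/andP; split.
  have /andP[h _] := infM xP; apply: (le_trans h); apply: ub_le_sup.
    by exists M => _ [y _ <-]; case/andP: (infM y).
  by exists xP.
apply: ge_sup; first by eexists; exists xP.
by move=> _ [y _ <-]; case/andP: (infM y).
Qed.

Let round_bounded t x xP xC : 0 < t ->
  `|u (t + delay v e x xP + delay (\- v) e xP xC, xC)| <= M.
Proof.
move=> t0; apply: game_value_bounded; rewrite -addrA addr_gt0//.
exact: duration_gt0.
Qed.

(** One round of the game: if Carol can answer every move of Paul so as to reach
    a point of value at most [a], the value is at most [a]. *)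
Lemma game_value_le t x a : 0 < t < T ->
  (forall xP, moves v e x xP -> exists2 xC, moves (\- v) e xP xC &
     u (t + duration v e x xP xC, xC) <= a) ->
  u (t, x) <= a.
Proof.
have [uE uS] := uval; move=> t0T ha; have /andP[t0 _] := t0T; rewrite uS//.
apply: ge_sup.
  by have [xP mP] := moves_neq0 v e x; eexists; exists xP.
move=> _ [xP /ha[xC mC uC] <-]; apply: le_trans uC.
rewrite addrA; apply: ge_inf; last by exists xC.
exists (- M) => _ [y _ <-].
by have := round_bounded x xP y t0; rewrite ler_norml => /andP[].
Qed.

Lemma game_value_ge t x a : 0 < t < T ->
  (exists2 xP, moves v e x xP & forall xC, moves (\- v) e xP xC ->
     a <= u (t + duration v e x xP xC, xC)) ->
  a <= u (t, x).
Proof.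
have [uE uS] := uval.
move=> t0T [xP mP ha]; have /andP[t0 _] := t0T; rewrite uS//.
apply: le_trans (_ : inf [set u (t + delay v e x xP + delay (\- v) e xP xC, xC)
     | xC in moves (\- v) e xP] <= _).
  apply: lb_le_inf.
    by have [xC mC] := moves_neq0 (\- v) e xP; eexists; exists xC.
  by move=> _ [xC /ha mC <-]; rewrite -addrA.
apply: ub_le_sup; last by exists xP.
exists M => _ [y _ <-]; have [xC mC] := moves_neq0 (\- v) e y.
apply: le_trans (_ : u (t + delay v e x y + delay (\- v) e y xC, xC) <= M).
  apply: ge_inf; last by exists xC.
  exists (- M) => _ [z _ <-].
  by have := round_bounded x y z t0; rewrite ler_norml => /andP[].
by have := round_bounded x y xC t0; rewrite ler_norml => /andP[].
Qed.

End Values.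

(** * Strict differentiability *)

Section StrictDifferentiability.
Context {R : realType} {N : nat}.
Implicit Types (phi : R * 'rV[R]_N -> R) (p q d : R * 'rV[R]_N).

(** [phi] is strictly differentiable at [p], with derivative [a] in time and
    gradient [g] in space: the error of the linear approximation between two
    points near [p] is small compared to the distance of the two points. *)
Definition strict_diff phi p (a : R) (g : 'rV[R]_N) : Prop :=
  forall k : R, 0 < k -> exists2 r : R, 0 < r & forall q q', `|q - p| < r ->
    `|q' - p| < r ->
    `|phi q' - phi q - (a * (q'.1 - q.1) + dot g (q'.2 - q.2))| <=
      k * (`|q'.1 - q.1| + enorm (q'.2 - q.2)).

Lemma strict_diffN phi p a g : strict_diff phi p a g ->
  strict_diff (fun q => - phi q) p (- a) (- g).
Proof.
move=> sd k k0; have [r r0 hr] := sd _ k0; exists r => // q q' qr q'r.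
apply: le_trans (hr _ _ qr q'r); rewrite -normrN le_eqVlt; apply/orP; left.
by apply/eqP; congr `|_|; rewrite dotNl /=; ring.
Qed.

Lemma deriveE_dt_grad phi p d : differentiable phi p ->
  'D_d phi p = dt phi p * d.1 + dot (grad phi p) d.2.
Proof.
move=> dphi; rewrite deriveE//.
have {1}-> : d = d.1 *: (1, 0) + \sum_(i < N) d.2 0 i *: (0, delta_mx 0 i).
  apply: injective_projections => /=; rewrite raddf_sum /=.
    rewrite big1 ?addr0 => [|i _]; [exact/esym/mulr1|exact: mulr0].
  by rewrite scaler0 add0r; exact: row_sum_delta.
rewrite linearD linearZ /= -deriveE// linear_sum mulrC; congr (_ + _).
apply: eq_bigr => i _; rewrite linearZ /= -deriveE// mxE mulrC.
by [].
Qed.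

Lemma derive_along phi p d (s : R) : differentiable phi (p + s *: d) ->
  is_derive s 1 (fun s => phi (p + s *: d)) ('D_d phi (p + s *: d)).
Proof.
move=> dphi.
have h : is_diff s (fun s : R => p + s *: d) (fun h => h *: d).
  by apply: is_diff_eq; apply/funext => h; rewrite !add0r.
have dc : differentiable (phi \o (fun s : R => p + s *: d)) s.
  by apply: differentiable_comp => //; exact: ex_diff.
split; first exact: diff_derivable.
rewrite [LHS]deriveE; last exact: dc.
rewrite diff_comp; [|exact: ex_diff|exact: dphi].
by rewrite /= diff_val scale1r deriveE.
Qed.

(** By the mean value theorem along the segment between two points. *)
Lemma C2_strict_diff (A : set (R * 'rV[R]_N)) phi p : C2_on A phi ->
  nbhs p A -> strict_diff phi p (dt phi p) (grad phi p).
Proof.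
move=> C2 /nbhs_normP[r0 /= r00 rA] k k0.
have Ap : A p by apply: rA; rewrite /ball_ /= subrr normr0.
have k1 : 0 < k / N.+1%:R by rewrite divr_gt0.
have cD d : {for p, continuous ('D_d phi)}.
  by apply: differentiable_continuous; have [_ /(_ d)[]] := C2 _ Ap.
have dtn : \forall q \near p, `|dt phi q - dt phi p| <= k / N.+1%:R.
  near=> q; rewrite distrC ltW//; near: q.
  by have /cvgrPdist_lt := cD (1, 0); exact.
have gni i : \forall q \near p, `|grad phi q 0 i - grad phi p 0 i| <= k / N.+1%:R.
  near=> q; rewrite !mxE distrC ltW//; near: q.
  by have /cvgrPdist_lt := cD (0, delta_mx 0 i); exact.
have gn := filter_forall (nbhs_filter p) gni.
have [r1 /= r10 rB] := (nbhs_normP _ _).1 (filterI dtn gn).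
exists (Num.min r0 r1); first by rewrite lt_min r00.
move=> q q'; rewrite !lt_min => /andP[q0 q1] /andP[q'0 q'1].
have seg (r c : R) : 0 <= c <= 1 -> `|q - p| < r -> `|q' - p| < r ->
    ball_ Num.norm p r (q + c *: (q' - q)).
  move=> /andP[c0 c1] qr q'r; rewrite /ball_ /= distrC.
  have -> : q + c *: (q' - q) - p = (1 - c) *: (q - p) + c *: (q' - p).
    have -> : q' - q = (q' - p) - (q - p) by rewrite opprB addrA subrK.
    rewrite scalerBl scale1r (scalerBr _ (q' - p)) addrAC -[RHS]addrA.
    by rewrite (addrC (- _)).
  rewrite (le_lt_trans (ler_normD _ _))// !normrZ !ger0_norm ?subr_ge0//.
  have [->|cn0] := eqVneq c 0; first by rewrite mul0r addr0 subr0 mul1r.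
  have cp : 0 < c by rewrite lt_def cn0.
  rewrite -[ltRHS]mul1r -[X in X * r](subrK c) [ltRHS]mulrDl.
  by rewrite ler_ltD ?ler_wpM2l ?subr_ge0// ?ltr_pM2l// ltW.
have dphi (c : R) : 0 <= c <= 1 -> differentiable phi (q + c *: (q' - q)).
  by move=> c01; have [] := C2 _ (rA _ (seg _ _ c01 q0 q'0)).
have [c c01 ->] : exists2 c : R, 0 <= c <= 1 &
    phi q' - phi q = 'D_(q' - q) phi (q + c *: (q' - q)).
  have h : forall x : R, x \in `]0, 1[%R -> is_derive x 1
      (fun s => phi (q + s *: (q' - q))) ('D_(q' - q) phi (q + x *: (q' - q))).
    move=> x; rewrite in_itv /= => /andP[x0 x1].
    by apply: derive_along; apply: dphi; rewrite !ltW.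
  have [|c] := MVT_segment ler01 h.
    apply: derivable_within_continuous => x; rewrite in_itv /= => x01.
    exact: (@ex_derive _ _ _ _ _ _ _ (derive_along (dphi _ x01))).
  rewrite in_itv /= => c01; rewrite scale1r scale0r addr0 (addrC q) subrK subr0 mulr1.
  by exists c.
rewrite deriveE_dt_grad; last exact: dphi.
have [dtz gz] := rB _ (seg _ _ c01 q1 q'1).
set z := q + _ in dtz gz *; set d := q' - q.
rewrite [X in `|X|](_ : _ = (dt phi z - dt phi p) * d.1 +
    dot (grad phi z - grad phi p) d.2); last first.
  by rewrite dotDl dotNl /d /=; ring.
rewrite (le_trans (ler_normD _ _))// [leRHS]mulrDr; apply: lerD.
  rewrite normrM ler_wpM2r// (le_trans dtz)// ler_piMr ?(ltW k0)//.
  by rewrite invf_le1 ?ler1n.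
have := cauchy_schwarz (grad phi z - grad phi p) d.2.
have := cauchy_schwarzN (grad phi z - grad phi p) d.2.
move=> c1 c2; apply: le_trans (_ : enorm (grad phi z - grad phi p) * enorm d.2 <= _).
  by rewrite ler_norml c1 c2.
rewrite ler_wpM2r ?enorm_ge0// (le_trans (enorm_le_normr _))//.
apply: le_trans (_ : N%:R * (k / N.+1%:R) <= _).
  rewrite ler_wpM2l// [leLHS]/Num.Def.normr /= mx_normrE.
  apply/bigmax_leP; split=> [|[i j] _ /=]; first exact: ltW.
  by have := gz j; rewrite ord1 !mxE.
by rewrite mulrCA ger_pMr// ler_pdivrMr// mul1r ler_nat.
Unshelve. all: by end_near.
Qed.

End StrictDifferentiability.

(** * Consistency of one round with the equation *)

Section Consistency.
Context {R : realType} {N : nat}.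
Implicit Types (phi : R * 'rV[R]_N -> R) (p q : R * 'rV[R]_N).
Implicit Types (v w : 'rV[R]_N -> R) (x y z xP xC : 'rV[R]_N) (e t : R).

Lemma prod_norm_lt p q (r : R) :
  (`|p - q| < r) = (`|p.1 - q.1| < r) && (`|p.2 - q.2| < r).
Proof. by rewrite [X in X < _]/Num.norm /= gt_max. Qed.

(** Along displacements of speed at most about [s], a function with time
    derivative [a] and gradient [g] such that [a + s * |g| < 0] decreases at a
    definite rate. *)
Lemma decrease_undirected phi p (a s : R) g : strict_diff phi p a g ->
  0 <= s -> a + s * enorm g < 0 ->
  exists c k r : R, [/\ 0 < c, 0 < k, 0 < r &
    forall q q', `|q - p| < r -> `|q' - p| < r -> 0 <= q'.1 - q.1 ->
      enorm (q'.2 - q.2) <= (s + k) * (q'.1 - q.1) ->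
      phi q' <= phi q - c * (q'.1 - q.1)].
Proof.
move=> sd s0 c0; have G0 := enorm_ge0 g.
set G := enorm g in c0 G0; set K := - (a + s * G) / (2 * (G + s + 2)).
have K0 : 0 < K by apply: divr_gt0; lra.
have KE : K * (G + s + 2) = - (a + s * G) / 2.
  by rewrite /K; field; rewrite gt_eqF//; lra.
set k := Num.min 1 K.
have k0 : 0 < k by rewrite lt_min ltr01.
have [k1 kK] : k <= 1 /\ k <= K by rewrite !ge_min !lexx orbT.
have [r r0 hr] := sd _ k0.
exists (- (a + s * G) / 2), k, r; split=> //; first lra.
move=> q q' qr q'r D0 hD; have := hr _ _ qr q'r.
have := cauchy_schwarz g (q'.2 - q.2); have h0 := enorm_ge0 (q'.2 - q.2).
rewrite (ger0_norm D0) ler_norml -/G.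
move: D0 hD h0; set D := q'.1 - q.1; set h := enorm _; set b := dot _ _.
move=> D0 hD h0 bh /andP[_ H].
have e1 : G * h <= G * ((s + k) * D) by rewrite ler_wpM2l.
have e2 : k * h <= k * ((s + k) * D) by rewrite ler_wpM2l// ltW.
have e3 : k * (k * D) <= k * D by rewrite ler_wpM2l ?ler_piMl// ltW.
have e4 : k * ((G + s + 2) * D) <= K * ((G + s + 2) * D).
  by rewrite ler_wpM2r// mulr_ge0//; lra.
have e5 : K * ((G + s + 2) * D) = - (a + s * G) / 2 * D by rewrite mulrA KE.
lra.
Qed.

(** The same along displacements of speed about [s] in the direction of
    steepest descent. *)
Lemma decrease_directed phi p (a s : R) g d : strict_diff phi p a g ->
  enorm d <= 1 -> dot g d = - enorm g -> 0 <= s -> a - s * enorm g < 0 ->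
  exists c k r : R, [/\ 0 < c, 0 < k, 0 < r &
    forall q q' (e : R), `|q - p| < r -> `|q' - p| < r -> 0 <= q'.1 - q.1 ->
      0 <= e -> q'.2 - q.2 = e *: d ->
      `|e - s * (q'.1 - q.1)| <= k * (q'.1 - q.1) ->
      phi q' <= phi q - c * (q'.1 - q.1)].
Proof.
move=> sd d1 gd s0 c0; have G0 := enorm_ge0 g.
set G := enorm g in gd c0 G0; set K := - (a - s * G) / (2 * (G + s + 2)).
have K0 : 0 < K by apply: divr_gt0; lra.
have KE : K * (G + s + 2) = - (a - s * G) / 2.
  by rewrite /K; field; rewrite gt_eqF//; lra.
set k := Num.min 1 K.
have k0 : 0 < k by rewrite lt_min ltr01.
have [k1 kK] : k <= 1 /\ k <= K by rewrite !ge_min !lexx orbT.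
have [r r0 hr] := sd _ k0.
exists (- (a - s * G) / 2), k, r; split=> //; first lra.
move=> q q' e qr q'r D0 e0 qe; have := hr _ _ qr q'r.
rewrite qe dotZr gd enormZ (ger0_norm e0) (ger0_norm D0) !ler_norml.
move: D0; set D := q'.1 - q.1; move=> D0 /andP[_ H] /andP[l1 l2].
have e1 : k * (e * enorm d) <= k * e.
  by rewrite ler_wpM2l ?(ltW k0)// ler_piMr.
have e2 : k * e <= k * ((s + k) * D) by rewrite ler_wpM2l ?(ltW k0)//; lra.
have e6 : G * ((s - k) * D) <= G * e by rewrite ler_wpM2l//; lra.
have e3 : k * (k * D) <= k * D by rewrite ler_wpM2l ?ler_piMl// ltW.
have e4 : k * ((G + s + 2) * D) <= K * ((G + s + 2) * D).
  by rewrite ler_wpM2r// mulr_ge0//; lra.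
have e5 : K * ((G + s + 2) * D) = - (a - s * G) / 2 * D by rewrite mulrA KE.
lra.
Qed.

(** For small [e], a round that starts near [p] stays near [p], and its mean
    speed is at most about [|v|] at [p]. *)
Lemma rounds_near v p (L k rho : R) : 0 < L ->
  (forall x y, `|v x - v y| <= L * `|x - y|) -> 0 < k -> 0 < rho ->
  exists2 r : R, 0 < r & forall e t x xP xC, 0 < e < r -> `|(t, x) - p| < r ->
    moves v e x xP -> moves (\- v) e xP xC ->
    [/\ 0 < e <= 1,
        enorm (xC - x) <= (`|v p.2| + k) * duration v e x xP xC
      & `|(t + duration v e x xP xC, xC) - p| < rho].
Proof.
move=> L0 vL k0 rho0; set a := Num.min 1 (Num.min k (rho / 4)).
have a0 : 0 < a by rewrite !lt_min ltr01 k0 divr_gt0.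
have [a1 ak arho] : [/\ a <= 1, a <= k & a <= rho / 4].
  by split; rewrite !ge_min !lexx ?orbT.
exists (Num.min (a ^+ 2) (k / (4 * L))).
  by rewrite lt_min exprn_gt0// divr_gt0// mulr_gt0.
move=> e t x xP xC /andP[e0]; rewrite lt_min => /andP[ea ek].
rewrite !prod_norm_lt /= !lt_min => /andP[/andP[ta tk] /andP[xa xk]] mP mC.
have aa : a ^+ 2 <= a by rewrite expr2 ler_piMr// ltW.
have e01 : 0 < e <= 1 by rewrite e0 (le_trans (ltW ea))// (le_trans aa).
have sa : e `^ (1 / 2) <= a by apply: powR_half_le; rewrite ?ltW.
have xPx : `|xP - x| <= e := le_trans (normr_le_enorm _) (moves_eball e0 mP).
have xCx : `|xC - x| <= 2 * e := le_trans (normr_le_enorm _) (round_eball e0 mP mC).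
have ekL : e * (4 * L) < k by rewrite -ltr_pdivlMr// mulr_gt0.
have xkL : `|x - p.2| * (4 * L) < k by rewrite -ltr_pdivlMr// mulr_gt0.
have near z : `|z - x| <= 2 * e -> `|v z| <= `|v p.2| + k.
  move=> zx; have := ler_normD (v z - v p.2) (v p.2); rewrite subrK.
  have := vL z p.2; have := ler_distD x z p.2.
  have : L * `|z - p.2| <= L * (2 * e + `|x - p.2|).
    rewrite ler_wpM2l ?(ltW L0)//; have := ler_distD x z p.2; lra.
  lra.
split=> //.
  apply: round_speed => //.
  - by apply: near; lra.
  - exact: near.
  - by rewrite (le_trans sa)// (le_trans ak)// lerDr.
have := duration_le v x xP xC e01; have := duration_gt0 v x xP xC e01.
move=> D0 D1; apply/andP; split.
  by move: ta; rewrite !ltr_norml; lra.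
by have := ler_distD x xC p.2; lra.
Qed.

(** Near a point where [w] is positive, the opponent of the player [w] is stuck,
    while the player may move by [e] in any direction, at a mean speed of about
    [w x0] even though the opponent wastes a time [e ^ 2]. *)
Lemma free_player_near w (x0 : 'rV[R]_N) (L k : R) : 0 < L ->
  (forall x y, `|w x - w y| <= L * `|x - y|) -> 0 < k -> 0 < w x0 ->
  exists2 r : R, 0 < r & forall e x, 0 < e < r -> `|x - x0| < r ->
    (forall z, enorm (z - x) <= 2 * e -> 0 <= w z) /\
    forall d, enorm d <= 1 -> moves w e x (x + e *: d) /\
      `|e - w x0 * (delay w e x (x + e *: d) + e ^+ 2)| <=
         k * (delay w e x (x + e *: d) + e ^+ 2).
Proof.
move=> L0 wL k0; set w0 := w x0 => w00.
set a := Num.min (w0 / 2) (2 * w0)^-1.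
have a0 : 0 < a by rewrite lt_min divr_gt0//= invr_gt0 mulr_gt0.
have [a1 a2] : a <= w0 / 2 /\ a <= (2 * w0)^-1.
  by split; rewrite !ge_min !lexx ?orbT.
set b := Num.min (w0 / 2) (k / 2).
have b0 : 0 < b by rewrite lt_min !divr_gt0.
have [b1 b2] : b <= w0 / 2 /\ b <= k / 2.
  by split; rewrite !ge_min !lexx ?orbT.
exists (Num.min (a ^+ 2) (Num.min (b / (3 * L)) (k / (4 * w0 ^+ 2)))).
  by rewrite !lt_min exprn_gt0// !divr_gt0// ?mulr_gt0// exprn_gt0.
move=> e x /andP[e0]; rewrite !lt_min => /and3P[ea eb ek] /and3P[xa xb xk].
have sa : e `^ (1 / 2) <= a by apply: powR_half_le; rewrite ?ltW.
have ebL : e * (3 * L) < b by rewrite -ltr_pdivlMr// mulr_gt0.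
have xbL : `|x - x0| * (3 * L) < b by rewrite -ltr_pdivlMr// mulr_gt0.
have near z : enorm (z - x) <= 2 * e -> `|w z - w0| <= b.
  move=> /(le_trans (normr_le_enorm _)) zx; apply: (le_trans (wL _ _)).
  have : L * `|z - x0| <= L * (2 * e + `|x - x0|).
    rewrite ler_wpM2l ?(ltW L0)//; have := ler_distD x z x0; lra.
  lra.
split=> [z /near|d d1]; first by rewrite ler_norml; lra.
have yx : enorm (x + e *: d - x) <= e.
  by rewrite addrC addKr enormZ gtr0_norm// ler_piMr// ltW.
set y := x + _ in yx *.
have wyb : - b <= w y - w0 <= b by rewrite -ler_norml; apply: near; lra.
have wy1 : w0 / 2 <= w y by lra.
have wy2 : w y <= 2 * w0 by lra.
have wy0 : 0 < w y by lra.
split; first exact: moves_free.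
have sy : e `^ (1 / 2) <= w y by lra.
have ys : w y * e `^ (1 / 2) <= 1.
  apply: le_trans (_ : (2 * w0) * (2 * w0)^-1 <= 1).
    by apply: ler_pM; rewrite ?powR_ge0 ?(ltW wy0)//; lra.
  by rewrite divff// gt_eqF// mulr_gt0.
have := delay_free e0 yx sy ys; set tau := delay w e x y => tauE.
have tau0 : 0 < tau by rewrite -(pmulr_lgt0 _ wy0) tauE.
have ekw : e * (4 * w0 ^+ 2) < k by rewrite -ltr_pdivlMr// mulr_gt0// exprn_gt0.
(* e ^ 2 = e * tau * w y is negligible compared to tau *)
have e1 : w0 * e ^+ 2 <= tau * (k / 2).
  have -> : w0 * e ^+ 2 = tau * (e * (w0 * w y)) by rewrite expr2 -{2}tauE; ring.
  rewrite ler_wpM2l ?(ltW tau0)//.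
  have : e * (w0 * w y) <= e * (w0 * (2 * w0)).
    by rewrite ler_wpM2l ?(ltW e0)// ler_wpM2l// ltW.
  lra.
have e2 : 0 <= w0 * e ^+ 2 by rewrite mulr_ge0 ?sqr_ge0// ltW.
have e3 : 0 <= k * e ^+ 2 by rewrite mulr_ge0 ?sqr_ge0// ltW.
have e4 : tau * (w y - w0) <= tau * b by rewrite ler_wpM2l ?(ltW tau0)//; lra.
have e5 : tau * - b <= tau * (w y - w0) by rewrite ler_wpM2l ?(ltW tau0)//; lra.
have e6 : tau * b <= tau * (k / 2) by rewrite ler_wpM2l ?(ltW tau0).
rewrite ler_norml; apply/andP; split; lra.
Qed.

(** If [a + v * |g|] is negative at [p], Carol can make a function with
    time derivative [a] and gradient [g] decrease at a definite rate. Where [v]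
    is nonnegative any answer will do; where [v] is negative, Paul is stuck and
    Carol follows the steepest descent. *)
Lemma consistency_le v phi p (L a rho : R) g : 0 < L ->
  (forall x y, `|v x - v y| <= L * `|x - y|) -> strict_diff phi p a g ->
  a + v p.2 * enorm g < 0 -> 0 < rho ->
  exists c r : R, [/\ 0 < c, 0 < r & forall e t x, 0 < e < r ->
    `|(t, x) - p| < r -> forall xP, moves v e x xP ->
    exists2 xC, moves (\- v) e xP xC &
      `|(t + duration v e x xP xC, xC) - p| < rho /\
      phi (t + duration v e x xP xC, xC) <=
        phi (t, x) - c * duration v e x xP xC].
Proof.
move=> L0 vL sd hneg rho0; have [v0|v0] := leP 0 (v p.2).
  have [c [k [r [c0 k0 r0 dec]]]] := decrease_undirected sd v0 hneg.
  have m0 : 0 < Num.min r rho by rewrite lt_min r0.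
  have [r1 r10 rn] := rounds_near p L0 vL k0 m0.
  exists c, (Num.min r r1); split=> //; first by rewrite lt_min r0.
  move=> e t x /andP[e0]; rewrite !lt_min => /andP[er er1] /andP[xr xr1] xP mP.
  have [xC mC] := moves_neq0 (\- v) e xP; exists xC => //.
  have [e01 sp] := rn _ _ _ _ _ (introT andP (conj e0 er1)) xr1 mP mC.
  rewrite lt_min => /andP[nr nrho]; split=> //.
  have := dec _ _ xr nr; rewrite /= addrAC subrr add0r; apply.
    by rewrite ltW// duration_gt0.
  by rewrite -{1}(ger0_norm v0).
have w0 : 0 < (\- v) p.2 by rewrite oppr_gt0.
have wL x y : `|(\- v) x - (\- v) y| <= L * `|x - y|.
  by rewrite /= -opprD normrN; exact: vL.
have [d d1 gd] := exists_direction (- g).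
have {}gd : dot g d = - enorm g by rewrite -enormN -gd dotNl opprK.
have hneg' : a - (\- v) p.2 * enorm g < 0 by rewrite /= mulNr opprK.
have [c [k [r [c0 k0 r0 dec]]]] := decrease_directed sd d1 gd (ltW w0) hneg'.
have m0 : 0 < Num.min r rho by rewrite lt_min r0.
have [r1 r10 rn] := rounds_near p L0 vL k0 m0.
have [r2 r20 fp] := free_player_near L0 wL k0 w0.
exists c, (Num.min r (Num.min r1 r2)); split=> //; first by rewrite !lt_min r0 r10.
move=> e t x /andP[e0]; rewrite !lt_min => /and3P[er er1 er2] /and3P[xr xr1 xr2].
move: (xr2); rewrite prod_norm_lt => /andP[_ /= xr2'].
have [wpos /(_ d d1)[mC dC]] := fp _ _ (introT andP (conj e0 er2)) xr2'.
have stuck z : enorm (z - x) <= e -> v z <= 0.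
  by move=> zx; rewrite -oppr_ge0; apply: wpos; lra.
move=> xP mP; have xPx := moves_stuck e0 stuck mP; subst xP.
exists (x + e *: d) => //.
have [e01 _] := rn _ _ _ _ _ (introT andP (conj e0 er1)) xr1 mP mC.
rewrite lt_min => /andP[nr nrho]; split=> //.
have := dec _ _ e xr nr; rewrite /= addrAC subrr add0r; apply.
- by rewrite ltW// duration_gt0.
- exact: ltW.
- by rewrite addrC addKr.
- by rewrite /duration (delay_stuck _ stuck) (addrC (e ^+ 2)).
Qed.

(** The counterpart for Paul: where [v] is positive, he follows the steepest
    ascent and Carol is stuck. *)
Lemma consistency_ge v phi p (L a rho : R) g : 0 < L ->
  (forall x y, `|v x - v y| <= L * `|x - y|) -> strict_diff phi p a g ->
  0 < a + v p.2 * enorm g -> 0 < rho ->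
  exists c r : R, [/\ 0 < c, 0 < r & forall e t x, 0 < e < r ->
    `|(t, x) - p| < r -> exists2 xP, moves v e x xP &
    forall xC, moves (\- v) e xP xC ->
      `|(t + duration v e x xP xC, xC) - p| < rho /\
      phi (t, x) + c * duration v e x xP xC <=
        phi (t + duration v e x xP xC, xC)].
Proof.
move=> L0 vL sd hpos rho0.
have {}sd := strict_diffN sd.
have [v0|v0] := leP (v p.2) 0.
  have s0 : 0 <= - v p.2 by rewrite oppr_ge0.
  have hneg : - a + - v p.2 * enorm (- g) < 0 by rewrite enormN; lra.
  have [c [k [r [c0 k0 r0 dec]]]] := decrease_undirected sd s0 hneg.
  have m0 : 0 < Num.min r rho by rewrite lt_min r0.
  have [r1 r10 rn] := rounds_near p L0 vL k0 m0.
  exists c, (Num.min r r1); split=> //; first by rewrite lt_min r0.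
  move=> e t x /andP[e0]; rewrite !lt_min => /andP[er er1] /andP[xr xr1].
  have [xP mP] := moves_neq0 v e x; exists xP => // xC mC.
  have [e01 sp] := rn _ _ _ _ _ (introT andP (conj e0 er1)) xr1 mP mC.
  rewrite lt_min => /andP[nr nrho]; split=> //.
  have := dec _ _ xr nr; rewrite /= addrAC subrr add0r => H.
  suff : - phi (t + duration v e x xP xC, xC) <=
    - phi (t, x) - c * duration v e x xP xC by lra.
  apply: H; first by rewrite ltW// duration_gt0.
  by rewrite -{1}(ler0_norm v0).
have [d d1 gd] := exists_direction g.
have {}gd : dot (- g) d = - enorm (- g) by rewrite enormN -gd dotNl.
have hneg : - a - v p.2 * enorm (- g) < 0 by rewrite enormN; lra.
have [c [k [r [c0 k0 r0 dec]]]] := decrease_directed sd d1 gd (ltW v0) hneg.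
have m0 : 0 < Num.min r rho by rewrite lt_min r0.
have [r1 r10 rn] := rounds_near p L0 vL k0 m0.
have [r2 r20 fp] := free_player_near L0 vL k0 v0.
exists c, (Num.min r (Num.min r1 r2)); split=> //; first by rewrite !lt_min r0 r10.
move=> e t x /andP[e0]; rewrite !lt_min => /and3P[er er1 er2] /and3P[xr xr1 xr2].
move: (xr2); rewrite prod_norm_lt => /andP[_ /= xr2'].
have [vpos /(_ d d1)[mP dP]] := fp _ _ (introT andP (conj e0 er2)) xr2'.
have xPx := moves_eball e0 mP.
have stuck z : enorm (z - (x + e *: d)) <= e -> (\- v) z <= 0.
  move=> zx; rewrite /= oppr_le0; apply: vpos.
  by have := enorm_dist_triangle (x + e *: d) z x; lra.
exists (x + e *: d) => // xC mC; have xCx := moves_stuck e0 stuck mC; subst xC.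
have [e01 _] := rn _ _ _ _ _ (introT andP (conj e0 er1)) xr1 mP mC.
rewrite lt_min => /andP[nr nrho]; split=> //.
set D := duration _ _ _ _ _ in nr nrho *.
have := dec _ _ e xr nr; rewrite /= addrAC subrr add0r => H.
suff : - phi (t + D, x + e *: d) <= - phi (t, x) - c * D by lra.
apply: H.
- by rewrite ltW// duration_gt0.
- exact: ltW.
- by rewrite addrC addKr.
- by rewrite /D /duration (delay_stuck _ stuck).
Qed.

End Consistency.

(** * Half-relaxed limits *)

Section Compactness.
Context {R : realType}.

(** Local bounds, uniform in a small parameter, hold uniformly on compact
    sets. *)
Lemma compact_uniform (V : normedModType R) (K : set V) (P : R -> V -> Prop) :
  compact K ->
  (forall p, K p -> exists2 d : R, 0 < d & forall (e : R) q, 0 < e < d ->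
     `|q - p| < d -> P e q) ->
  exists2 d : R, 0 < d & forall (e : R) q, 0 < e < d -> K q -> P e q.
Proof.
move=> /compact_near_coveringP cK h.
have := cK _ (0^'+ : set_system R) P _; case.
  move=> p Kp; have [d d0 hd] := h _ Kp.
  exists (ball p d, [set e | 0 < e < d]) => /=.
    split; first exact: nbhsx_ballx.
    near=> e; apply/andP; split; first by near: e; exact: nbhs_right_gt.
    by near: e; exact: nbhs_right_lt.
  move=> [q e] /= [qd ed]; apply: hd => //.
  by move: qd; rewrite -ball_normE /ball_ /= distrC.
move=> d /= d0 hd; exists d => // e q /andP[e0 ed] Kq.
apply: (hd e) => //=.
by rewrite sub0r normrN gtr0_norm.
Unshelve. all: by end_near.
Qed.

Lemma compact_closed_bounded N (A : set (R * 'rV[R]_N)) (p : R * 'rV[R]_N)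
    (r : R) :
  closed A -> (forall q, A q -> `|q - p| <= r) -> compact A.
Proof.
move=> cA Ar.
pose B := `[p.1 - r, p.1 + r]%classic `*` [set x : 'rV[R]_N | `|x - p.2| <= r].
have cB : compact B.
  apply: compact_setX; first exact: segment_compact.
  apply: bounded_closed_compact.
    exists (`|p.2| + r); split; first exact: num_real.
    move=> M rM x /= xr; rewrite -(subrK p.2 x) (le_trans (ler_normD _ _))//.
    by rewrite (le_trans _ (ltW rM))// addrC lerD2l.
  have -> : [set x : 'rV[R]_N | `|x - p.2| <= r] = closed_ball_ Num.norm p.2 r.
    by apply/seteqP; split => x /=; rewrite distrC.
  exact: closed_closed_ball_.
apply: (subclosed_compact cA cB) => q /Ar qr.
split=> /=; last by rewrite (le_trans _ qr)// [leRHS]/Num.norm /= le_max lexx orbT.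
rewrite in_itv /= -ler_distlC distrC (le_trans _ qr)//.
by rewrite [leRHS]/Num.norm /= le_max lexx.
Qed.

End Compactness.

Section SquaredDistance.
Context {R : realType} {N : nat}.
Implicit Types p q : R * 'rV[R]_N.

(** The squared Euclidean distance in space-time. *)
Definition sqdist p q : R :=
  (q.1 - p.1) ^+ 2 + dot (q.2 - p.2) (q.2 - p.2).

Lemma normr_le_sqdist p q : `|q - p| ^+ 2 <= sqdist p q.
Proof.
have -> : `|q - p| = Num.max `|q.1 - p.1| `|q.2 - p.2| by [].
rewrite /sqdist -sqr_enorm; have [_|_] := leP `|q.1 - p.1| `|q.2 - p.2|.
  apply: le_trans (_ : enorm (q.2 - p.2) ^+ 2 <= _); last by rewrite lerDr sqr_ge0.
  by rewrite lerXn2r ?nnegrE ?enorm_ge0// normr_le_enorm.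
by rewrite real_normK ?num_real// lerDl sqr_ge0.
Qed.

Lemma sqdist_ge0 p q : 0 <= sqdist p q.
Proof. by rewrite (le_trans _ (normr_le_sqdist _ _))// sqr_ge0. Qed.

Lemma sqdist_le_normr p q : sqdist p q <= (1 + N%:R ^+ 2) * `|q - p| ^+ 2.
Proof.
rewrite mulrDl mul1r; apply: lerD.
  rewrite -real_normK ?num_real// lerXn2r ?nnegrE//.
  by rewrite [leRHS]/Num.norm /= le_max lexx.
rewrite -sqr_enorm -exprMn lerXn2r ?nnegrE ?enorm_ge0 ?mulr_ge0//.
rewrite (le_trans (enorm_le_normr _))// ler_wpM2l//.
by rewrite [leRHS]/Num.norm /= le_max lexx orbT.
Qed.

(** The squared distance to [p] has a vanishing strict derivative at [p]. *)
Lemma strict_diff_add_sqdist (phi : R * 'rV[R]_N -> R) p a g :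
  strict_diff phi p a g -> strict_diff (fun q => phi q + sqdist p q) p a g.
Proof.
move=> sd k k0; have k2 : 0 < k / 2 by rewrite divr_gt0.
have [r r0 hr] := sd _ k2.
set c := (N.+1%:R : R) * 4; have c0 : 0 < c by rewrite mulr_gt0.
exists (Num.min r (k / c)); first by rewrite lt_min r0 divr_gt0.
move=> q q'; rewrite !lt_min => /andP[qr qc] /andP[q'r q'c].
have := hr _ _ qr q'r.
set A := phi q' - phi q - _ => hA.
have -> : phi q' + sqdist p q' - (phi q + sqdist p q) -
    (a * (q'.1 - q.1) + dot g (q'.2 - q.2)) =
  A + ((q'.1 - q.1) * ((q'.1 - p.1) + (q.1 - p.1)) +
       dot (q'.2 - q.2) ((q'.2 - p.2) + (q.2 - p.2))).
  rewrite /A /sqdist !(dotDl, dotDr, dotNl, dotNr).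
  rewrite (dotC q'.2 p.2) (dotC q.2 p.2) (dotC q'.2 q.2); ring.
have fst_le z : `|z.1 - p.1| <= `|z - p| by rewrite [leRHS]/Num.norm /= le_max lexx.
have snd_le z : `|z.2 - p.2| <= `|z - p|.
  by rewrite [leRHS]/Num.norm /= le_max lexx orbT.
have kc : (k / c) * 2 * N.+1%:R = k / 2.
  have : (0 : R) < N.+1%:R by [].
  by rewrite /c; set n := N.+1%:R => n0; field; rewrite gt_eqF.
have kN : (k / c) * 2 <= k / 2.
  rewrite -kc ler_peMr ?ler1n// mulr_ge0// ltW// divr_gt0//.
have t1 : `|(q'.1 - q.1) * ((q'.1 - p.1) + (q.1 - p.1))| <= `|q'.1 - q.1| * (k / 2).
  rewrite normrM ler_wpM2l// (le_trans (ler_normD _ _))//.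
  by have := fst_le q; have := fst_le q'; lra.
have t2 : `|dot (q'.2 - q.2) ((q'.2 - p.2) + (q.2 - p.2))| <=
    enorm (q'.2 - q.2) * (k / 2).
  set y := _ + (q.2 - p.2).
  apply: le_trans (_ : enorm (q'.2 - q.2) * enorm y <= _).
    by rewrite ler_norml cauchy_schwarz andbT cauchy_schwarzN.
  rewrite ler_wpM2l ?enorm_ge0// (le_trans (enorm_le_normr _))//.
  apply: le_trans (_ : N%:R * ((k / c) * 2) <= _).
    rewrite ler_wpM2l// (le_trans (ler_normD _ _))//.
    by have := snd_le q; have := snd_le q'; lra.
  rewrite -kc [leRHS]mulrC ler_wpM2r ?ler_nat// mulr_ge0// ltW// divr_gt0//.
have := ler_normD ((q'.1 - q.1) * ((q'.1 - p.1) + (q.1 - p.1)))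
  (dot (q'.2 - q.2) ((q'.2 - p.2) + (q.2 - p.2))).
have := ler_normD A ((q'.1 - q.1) * ((q'.1 - p.1) + (q.1 - p.1)) +
  dot (q'.2 - q.2) ((q'.2 - p.2) + (q.2 - p.2))).
lra.
Qed.

End SquaredDistance.

Section RelaxedLimit.
Context {R : realType} {N : nat} (T : R) (f : R -> R * 'rV[R]_N -> R) (M : R).
Implicit Types (p q : R * 'rV[R]_N) (e d a m : R) (phi : R * 'rV[R]_N -> R).

(** The upper half-relaxed limit, as [e] tends to zero, of a family of functions
    on the cylinder closed at its terminal time: the infimum of the numbers that
    are upper bounds of the family locally around [p]. *)
Definition relaxed_sup p : R :=
  inf [set a | exists2 d : R, 0 < d & forall e q, 0 < e < d -> `|q - p| < d ->
    cylinderT T q -> f e q <= a].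

Hypothesis fM : forall e p, 0 < e <= 1 -> cylinderT T p -> `|f e p| <= M.

Let lb p : cylinderT T p -> lbound
  [set a | exists2 d : R, 0 < d & forall e q, 0 < e < d -> `|q - p| < d ->
    cylinderT T q -> f e q <= a] (- M).
Proof.
move=> Tp a [d d0 hd]; set e := Num.min 1 (d / 2).
have e0 : 0 < e by rewrite lt_min ltr01 divr_gt0.
have [e1 ed] : e <= 1 /\ e <= d / 2 by rewrite !ge_min !lexx orbT.
apply: le_trans (hd e p _ _ Tp).
- have : `|f e p| <= M by apply: fM; rewrite ?e0.
  by rewrite ler_norml => /andP[].
- by rewrite e0; lra.
- by rewrite subrr normr0.
Qed.

Let ne p : [set a | exists2 d : R, 0 < d & forall e q, 0 < e < d ->
  `|q - p| < d -> cylinderT T q -> f e q <= a] !=set0.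
Proof.
exists M; exists 1 => // e q /andP[e0 e1] _ Tq.
have : `|f e q| <= M by apply: fM; rewrite // e0 ltW.
by rewrite ler_norml => /andP[].
Qed.

Lemma relaxed_sup_lt p a : cylinderT T p -> relaxed_sup p < a ->
  exists2 d : R, 0 < d & forall e q, 0 < e < d -> `|q - p| < d ->
    cylinderT T q -> f e q <= a.
Proof.
move=> Tp Ua; have hi : has_inf [set a | exists2 d : R, 0 < d & forall e q,
    0 < e < d -> `|q - p| < d -> cylinderT T q -> f e q <= a].
  by split; [exact: ne|exists (- M); exact: lb].
have a0 : 0 < a - relaxed_sup p by rewrite subr_gt0.
have [b [d d0 hd] ba] := inf_adherent a0 hi; exists d => // e q ed qd Tq.
by rewrite (le_trans (hd _ _ ed qd Tq))// ltW// (lt_le_trans ba)// addrC subrK.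
Qed.

Lemma relaxed_sup_le p a d : cylinderT T p -> 0 < d ->
  (forall e q, 0 < e < d -> `|q - p| < d -> cylinderT T q -> f e q <= a) ->
  relaxed_sup p <= a.
Proof.
by move=> Tp d0 hd; apply: ge_inf; [exists (- M); exact: lb|exists d].
Qed.

Lemma relaxed_sup_gt p a d : cylinderT T p -> a < relaxed_sup p -> 0 < d ->
  exists e q, [/\ 0 < e < d, `|q - p| < d, cylinderT T q & a < f e q].
Proof.
move=> Tp aU d0; apply: contrapT => h; move: aU; rewrite ltNge => /negP; apply.
apply: (relaxed_sup_le Tp d0) => e q ed qd Tq.
by rewrite leNgt; apply/negP => fa; apply: h; exists e, q.
Qed.

Lemma relaxed_sup_usc : usc_on (cylinderT T) relaxed_sup.
Proof.
move=> p Tp a Ua; have [b /andP[Ub ba]] : exists b, relaxed_sup p < b < a.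
  by exists ((relaxed_sup p + a) / 2); rewrite midf_lt//= midf_lt.
have [d d0 hd] := relaxed_sup_lt Tp Ub.
suff : \forall q \near p, cylinderT T q -> relaxed_sup q < a by [].
apply/nbhs_normP; exists (d / 2); first exact: divr_gt0.
move=> q /=; rewrite distrC => qp Tq; apply: le_lt_trans ba.
have d2 : 0 < d / 2 by rewrite divr_gt0.
apply: (relaxed_sup_le Tq d2) => e z /andP[e0 ed] zq Tz.
apply: hd => //; first by rewrite e0; lra.
by have := ler_distD q z p; lra.
Qed.

(** Let [relaxed_sup - phi] be maximal at [p] on a ball around [p]. Once [phi]
    is increased by the squared distance to [p], which makes the maximum strict,
    there are points [q] near [p] at which [f e - phi - sqdist p] is maximal on
    the ball up to [e ^ 3], for arbitrarily small [e]. *)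
Lemma relaxed_sup_test p phi (rho : R) : 0 < rho ->
  (forall q, `|q - p| <= rho -> cylinder T q) ->
  (forall q, `|q - p| <= rho -> {for q, continuous phi}) ->
  (forall q, `|q - p| <= rho -> relaxed_sup q - phi q <= relaxed_sup p - phi p) ->
  forall r : R, 0 < r -> exists e q m, [/\ 0 < e < r, `|q - p| < r,
    (forall z, `|z - p| <= rho -> f e z <= phi z + sqdist p z + m) &
    phi q + sqdist p q + m - e ^+ 3 <= f e q].
Proof.
move=> rho0 cyl cphi maxU r' r'0.
set r := Num.min r' (Num.min rho 1).
have r0 : 0 < r by rewrite !lt_min r'0 rho0 /=.
have [rr' [rrho r1]] : r <= r' /\ r <= rho /\ r <= 1.
  by rewrite !ge_min !lexx ?orbT.
clearbody r.
set k : R := r ^+ 2 / 4; have k0 : 0 < k by rewrite divr_gt0// exprn_gt0.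
set a := relaxed_sup p - phi p.
have cylT q : cylinder T q -> cylinderT T q.
  by rewrite /cylinder /cylinderT /= => /andP[-> /ltW].
have Bp : `|p - p| <= rho by rewrite subrr normr0 ltW.
have cB : compact [set q | `|q - p| <= rho].
  apply: (@compact_closed_bounded _ _ _ p rho) => //.
  have -> : [set q | `|q - p| <= rho] = closed_ball_ Num.norm p rho.
    by apply/seteqP; split => x /=; rewrite distrC.
  exact: closed_closed_ball_.
have [|d d0 hd'] := compact_uniform (P := fun e q => `|q - p| <= rho ->
    f e q <= phi q + a + k) cB.
  move=> q Bq; have Tq := cyl _ Bq.
  have Uq : relaxed_sup q < phi q + a + k / 2.
    by have := maxU _ Bq; rewrite -/a; move: k0; lra.
  have [d1 d10 hd1] := relaxed_sup_lt (cylT _ Tq) Uq.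
  have k2 : 0 < k / 2 by rewrite divr_gt0.
  have /cvgrPdist_lt/(_ _ k2)/nbhs_normP[d2 /= d20 hd2] := cphi _ Bq.
  exists (Num.min d1 d2); first by rewrite lt_min d10.
  move=> e z /andP[e0]; rewrite !lt_min => /andP[ed1 _] /andP[zd1 zd2] Bz.
  have := hd1 e z (introT andP (conj e0 ed1)) zd1 (cylT _ (cyl _ Bz)).
  have /hd2 /= : ball_ Num.norm q d2 z by rewrite /ball_ /= distrC.
  by rewrite ltr_norml; lra.
have hd e q ed Bq := hd' e q ed Bq Bq.
have k2 : 0 < k / 2 by rewrite divr_gt0.
have /cvgrPdist_lt/(_ _ k2)/nbhs_normP[d2 /= d20 hd2] := cphi _ Bp.
set c := 1 + N%:R ^+ 2 : R.
have c0 : 0 < c by rewrite ltr_wpDr ?sqr_ge0.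
have c1 : 1 <= c by rewrite lerDl sqr_ge0.
set s := Num.min (Num.min d (k / (2 * c))) (Num.min d2 (Num.min r k)).
have s0 : 0 < s by rewrite 4!lt_min d0 d20 r0 k0 divr_gt0// mulr_gt0.
have Up : relaxed_sup p - k / 2 < relaxed_sup p by move: k0; lra.
have [e [q1 [/andP[e0]]]] := relaxed_sup_gt (cylT _ (cyl _ Bp)) Up s0.
rewrite !lt_min => /andP[/andP[ed ec] /and3P[ed2 er ek]].
move=> /andP[/andP[qd qc] /and3P[qd2 qr qk]] Tq1 fq1.
have e3 : e ^+ 3 <= k.
  by rewrite (le_trans _ (ltW ek))// ler_iXnr ?(ltW e0)// (le_trans (ltW er)).
(* q1 is a competitor in the maximization of f e - phi - sqdist p *)
have sq1 : sqdist p q1 <= k / 2.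
  apply: (le_trans (sqdist_le_normr _ _)); rewrite -/c.
  apply: le_trans (_ : c * `|q1 - p| <= _).
    by rewrite ler_wpM2l ?(ltW c0)// ler_iXnr// (le_trans (ltW qr)).
  move: qc; rewrite ltr_pdivlMr ?mulr_gt0//; lra.
have Bq1 : `|q1 - p| <= rho by rewrite (le_trans (ltW qr)).
pose S := [set f e q - phi q - sqdist p q | q in [set q | `|q - p| <= rho]].
have hS : has_sup S.
  split; first by exists (f e p - phi p - sqdist p p), p.
  exists (a + k) => _ [q Bq <-]; have := hd e q (introT andP (conj e0 ed)) Bq.
  by have := sqdist_ge0 p q; lra.
have e30 : 0 < e ^+ 3 by rewrite exprn_gt0.
have [_ [q Bq <-] hq] := sup_adherent e30 hS.
have supq1 : f e q1 - phi q1 - sqdist p q1 <= sup S.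
  by apply: ub_le_sup; [case: hS|exists q1].
exists e, q, (sup S); split.
- by rewrite e0 (lt_le_trans er).
- have : `|q - p| ^+ 2 < r ^+ 2.
    apply: (le_lt_trans (normr_le_sqdist _ _)).
    have := hd e q (introT andP (conj e0 ed)) Bq.
    have /hd2 /= : ball_ Num.norm p d2 q1 by rewrite /ball_ /= distrC.
    have r4 : r ^+ 2 = 4 * k by rewrite /k; field.
    move: k0 hq supq1 fq1 sq1 e3 r4; rewrite ltr_norml /a; lra.
  by rewrite ltr_pXn2r ?nnegrE ?(ltW r0)// => /lt_le_trans; apply.
- move=> z Bz; have : f e z - phi z - sqdist p z <= sup S.
    by apply: ub_le_sup; [case: hS|exists z].
  lra.
- by move: hq; lra.
Qed.

End RelaxedLimit.

(** * The terminal value *)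

Section TerminalLayer.
Context {R : realType} {N : nat} (T : R) (v uT : 'rV[R]_N -> R) (L Lu M : R).
Hypotheses (L0 : 0 < L) (Lu0 : 0 < Lu).
Hypothesis vL : forall x y, `|v x - v y| <= L * `|x - y|.
Hypothesis uTL : forall x y, `|uT x - uT y| <= Lu * `|x - y|.
Hypothesis uTM : forall x, `|uT x| <= M.
Implicit Types (x y : 'rV[R]_N) (e t : R).

(** Since [v] grows at most linearly, [1 + |x - x0|] grows at most exponentially
    along a play; hence a play that starts at time [t] close to [T] and at [x]
    close to [x0] ends close to [x0]. *)
Lemma terminal_layer e u x0 t x (A := `|v x0| + L + 1) : 0 < e <= 1 / 2 ->
  is_game_value T v uT e u -> 0 < t -> t <= T + 2 * e `^ (1 / 2) ->
  `|u (t, x) - uT x0| <= Lu * ((1 + enorm (x - x0)) *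
     expR (2 * A * (T + 2 * e `^ (1 / 2) - t)) - 1).
Proof.
move=> /andP[e0 e12] uval; set s := e `^ (1 / 2); move=> t0.
have e01 : 0 < e <= 1 by rewrite e0; lra.
have s1 : s <= 1 by apply: powR_half_le => //; rewrite expr1n; lra.
have A1 : 1 <= A by have := normr_ge0 (v x0); move: L0; rewrite /A; lra.
have [uE uS] := uval.
apply: (@time_ind _ _ T e e01 (fun t x => t <= T + 2 * s ->
  `|u (t, x) - uT x0| <= Lu * ((1 + enorm (x - x0)) *
    expR (2 * A * (T + 2 * s - t)) - 1))) => // {t x t0} [t x Tt tT|t x t0T IH _].
  rewrite uE// (le_trans (uTL _ _))// ler_wpM2l ?(ltW Lu0)//.
  have h0 := normr_le_enorm (x - x0); have h1 := enorm_ge0 (x - x0).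
  have : 1 <= expR (2 * A * (T + 2 * s - t)).
    by rewrite (le_trans _ (expR_ge1Dx _))// lerDl mulr_ge0//; lra.
  move=> E1; have := ler_wpM2l (_ : 0 <= 1 + enorm (x - x0)) E1; lra.
have D0 y : 0 <= enorm (y - x0) := enorm_ge0 _.
have vD y : `|v y| <= A * (1 + enorm (y - x0)).
  have := ler_normD (v y - v x0) (v x0); rewrite subrK.
  have := vL y x0.
  have : L * `|y - x0| <= L * enorm (y - x0).
    by rewrite ler_wpM2l ?normr_le_enorm// ltW.
  have := mulr_ge0 (normr_ge0 (v x0)) (D0 y).
  have := mulr_ge0 (ltW L0) (D0 y).
  by have := D0 y; rewrite /A; move: L0; lra.
have step xP xC : moves v e x xP -> moves (\- v) e xP xC ->
    `|u (t + duration v e x xP xC, xC) - uT x0| <=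
    Lu * ((1 + enorm (x - x0)) * expR (2 * A * (T + 2 * s - t)) - 1).
  move=> mP mC; have d0 := duration_gt0 v x xP xC e01.
  have d1 := duration_le v x xP xC e01.
  set D := duration _ _ _ _ _ in d0 d1 *.
  have /andP[_ tT] := t0T.
  apply: le_trans (IH _ xC _ _) _.
  - by rewrite lerD2l duration_ge.
  - by rewrite -/s in d1; lra.
  rewrite ler_wpM2l ?(ltW Lu0)// lerD2r.
  have -> : 2 * A * (T + 2 * s - t) = 2 * A * D + 2 * A * (T + 2 * s - (t + D)).
    by ring.
  rewrite expRD mulrA ler_wpM2r ?expR_ge0//.
  have xPx := moves_eball e0 mP; have xCx := round_eball e0 mP mC.
  (* as e <= 1/2, a round at most doubles 1 + |x - x0| *)
  have K y : enorm (y - x) <= 2 * e -> `|v y| <= 2 * A * (1 + enorm (x - x0)).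
    move=> yx; apply: le_trans (vD y) _.
    rewrite [2 * A]mulrC -mulrA ler_wpM2l//; first lra.
    by have := enorm_dist_triangle x y x0; have := D0 x; lra.
  have sp : enorm (xC - x) <= 2 * A * (1 + enorm (x - x0)) * D.
    apply: round_speed => //; [apply: K; lra|exact: K|].
    rewrite -/s; apply: (le_trans s1).
    rewrite -[leLHS]mulr1 ler_pM//; first lra.
    by rewrite lerDl.
  apply: le_trans (_ : (1 + enorm (x - x0)) * (1 + 2 * A * D) <= _).
    by have := enorm_dist_triangle x xC x0; lra.
  by rewrite ler_wpM2l ?expR_ge1Dx// addr_ge0.
rewrite ler_norml lerBlDl lerBrDl; apply/andP; split.
  apply: (game_value_ge e01 uval uTM t0T).
  have [xP mP] := moves_neq0 v e x; exists xP => // xC mC.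
  by have := step _ _ mP mC; rewrite ler_norml; lra.
apply: (game_value_le e01 uval uTM t0T) => xP mP.
have [xC mC] := moves_neq0 (\- v) e xP; exists xC => //.
by have := step _ _ mP mC; rewrite ler_norml; lra.
Qed.

(** The value functions attain the terminal value uniformly in [e]. *)
Lemma terminal_convergence (ueps : R -> R * 'rV[R]_N -> R) x0 (eta : R) :
  (forall e, 0 < e -> is_game_value T v uT e (ueps e)) -> 0 < eta ->
  exists2 d : R, 0 < d & forall e q, 0 < e < d -> `|q - (T, x0)| < d ->
    cylinderT T q -> `|ueps e q - uT x0| <= eta.
Proof.
move=> hu eta0; set A := `|v x0| + L + 1.
have A1 : 1 <= A by have := normr_ge0 (v x0); move: L0; rewrite /A; lra.
set b := Num.min 1 (eta / (4 * Lu)).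
have b0 : 0 < b by rewrite lt_min ltr01 divr_gt0// mulr_gt0.
have [b1 bL] : b <= 1 /\ b <= eta / (4 * Lu) by rewrite !ge_min !lexx orbT.
have {bL} : b * (4 * Lu) <= eta by rewrite -ler_pdivlMr// mulr_gt0.
clearbody b => bL.
have [c c0 hc] : exists2 c : R, 0 < c & forall z, `|z| < c -> expR z <= 1 + b.
  have := @continuous_expR R 0; move=> /cvgrPdist_lt/(_ _ b0)/nbhs_normP[c /= c0 hc].
  exists c => // z zc; have /hc : ball_ Num.norm 0 c z by rewrite /ball_ /= sub0r normrN.
  by rewrite /= expR0 ltr_norml; lra.
set a := Num.min 1 (c / (8 * A)).
have a0 : 0 < a by rewrite lt_min ltr01 divr_gt0// mulr_gt0//; lra.
have [a1 aA] : a <= 1 /\ a <= c / (8 * A) by rewrite !ge_min !lexx orbT.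
have {aA} : a * (8 * A) <= c by rewrite -ler_pdivlMr// mulr_gt0//; lra.
clearbody a => aA.
exists (Num.min (1 / 2) (Num.min (a ^+ 2) (b / N.+1%:R))).
  by rewrite !lt_min divr_gt0// exprn_gt0// divr_gt0.
move=> e [t x] /andP[e0]; rewrite !lt_min => /and3P[e12 ea _].
move=> /and3P[_ qa qb]; rewrite /cylinderT /= => /andP[t0 tT].
have sa : e `^ (1 / 2) <= a by apply: powR_half_le => //; exact: ltW.
have s0 := powR_half_gt0 e0.
have aa : a ^+ 2 <= a by rewrite expr2 ler_piMr// ltW.
have /andP[] : (`|t - T| < a ^+ 2) && (`|x - x0| < a ^+ 2).
  by have := prod_norm_lt (t, x) (T, x0) (a ^+ 2); rewrite qa.
rewrite ltr_norml => /andP[ta _] _.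
have /andP[_ xb] : (`|t - T| < b / N.+1%:R) && (`|x - x0| < b / N.+1%:R).
  by have := prod_norm_lt (t, x) (T, x0) (b / N.+1%:R); rewrite qb.
have xb' : enorm (x - x0) <= b.
  rewrite (le_trans (enorm_le_normr _))//.
  move: xb; rewrite ltr_pdivlMr// => xb; rewrite mulrC (le_trans _ (ltW xb))//.
  by rewrite ler_wpM2l// ler_nat.
apply: le_trans (terminal_layer x0 x _ (hu _ e0) t0 _) _.
- by rewrite e0 ltW.
- lra.
rewrite -/A; set s := e `^ _ in sa s0 *.
have z0 : 0 <= T + 2 * s - t by lra.
have E1 : expR (2 * A * (T + 2 * s - t)) <= 1 + b.
  apply: hc; rewrite ger0_norm ?mulr_ge0//; last lra.
  apply: lt_le_trans aA.
  have : 2 * A * (T + 2 * s - t) < 2 * A * (4 * a); last lra.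
  by rewrite ltr_pM2l; lra.
have h0 := enorm_ge0 (x - x0).
have : (1 + enorm (x - x0)) * expR (2 * A * (T + 2 * s - t)) <= (1 + b) * (1 + b).
  by rewrite ler_pM ?expR_ge0//; lra.
move=> E2; apply: le_trans (_ : Lu * (4 * b) <= _); last lra.
rewrite ler_wpM2l ?(ltW Lu0)//.
have : b * b <= b by rewrite ler_piMr// ltW.
lra.
Qed.

End TerminalLayer.

(** * The relaxed limits of the value functions *)

Section Semicontinuity.
Context {R : realType} {N : nat}.
Implicit Types (p q : R * 'rV[R]_N) (u phi : R * 'rV[R]_N -> R).

Lemma within_continuous_usc_lsc (A : set (R * 'rV[R]_N)) u :
  {within A, continuous u} <-> usc_on A u /\ lsc_on A u.
Proof.
split=> [cu|[us ls]].
  have {}cu := (@subspace_continuousP _ _ _ u).1 cu.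
  split=> p Ap a ua.
    by have /cvgr_lt := cu p Ap; apply.
  by have /cvgr_gt := cu p Ap; apply.
apply/(@subspace_continuousP _ _ _ u).2 => p Ap; apply/cvgrPdist_lt => k k0.
have h1 := us p Ap (u p + k) ltac:(by rewrite ltrDl).
have h2 := ls p Ap (u p - k) ltac:(by rewrite gtrBl).
by apply: filterS2 h1 h2 => q; rewrite ltr_norml; lra.
Qed.

Lemma usc_on_sub (A B : set (R * 'rV[R]_N)) u : A `<=` B -> usc_on B u ->
  usc_on A u.
Proof.
move=> AB uB p Ap a ua.
have h : \forall q \near p, B q -> u q < a by exact: uB (AB _ Ap) _ ua.
suff : \forall q \near p, A q -> u q < a by [].
by apply: filterS h => q h Aq; apply: h; exact: AB.
Qed.

Lemma lsc_on_sub (A B : set (R * 'rV[R]_N)) u : A `<=` B -> lsc_on B u ->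
  lsc_on A u.
Proof.
move=> AB uB p Ap a ua.
have h : \forall q \near p, B q -> a < u q by exact: uB (AB _ Ap) _ ua.
suff : \forall q \near p, A q -> a < u q by [].
by apply: filterS h => q h Aq; apply: h; exact: AB.
Qed.

Lemma C2_continuous (A : set (R * 'rV[R]_N)) phi : C2_on A phi ->
  forall q, A q -> {for q, continuous phi}.
Proof.
by move=> C2 q Aq; apply: differentiable_continuous; have [] := C2 _ Aq.
Qed.

End Semicontinuity.

Section RelaxedLimitsOfGame.
Context {R : realType} {N : nat} (T : R) (v uT : 'rV[R]_N -> R) (L Lu M : R).
Variable ueps : R -> R * 'rV[R]_N -> R.
Hypotheses (L0 : 0 < L) (Lu0 : 0 < Lu).
Hypothesis vL : forall x y, `|v x - v y| <= L * `|x - y|.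
Hypothesis uTL : forall x y, `|uT x - uT y| <= Lu * `|x - y|.
Hypothesis uTM : forall x, `|uT x| <= M.
Hypothesis hu : forall e, 0 < e -> is_game_value T v uT e (ueps e).
Implicit Types (x y : 'rV[R]_N) (p q : R * 'rV[R]_N) (e : R).
Implicit Types phi : R * 'rV[R]_N -> R.

(** The two half-relaxed limits of the value functions. *)
Definition upper_limit : R * 'rV[R]_N -> R := relaxed_sup T ueps.

Definition lower_limit p : R := - relaxed_sup T (fun e q => - ueps e q) p.

Lemma cylinderW p : cylinder T p -> cylinderT T p.
Proof. by rewrite /cylinder /cylinderT /= => /andP[-> /ltW]. Qed.

Lemma cylinder_ball p : cylinder T p -> exists2 rho : R, 0 < rho &
  forall q, `|q - p| <= rho -> cylinder T q.
Proof.
rewrite /cylinder /= => /andP[p0 pT].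
exists (Num.min p.1 (T - p.1) / 2); first by rewrite divr_gt0// lt_min p0 subr_gt0.
move=> q qp; have : `|q.1 - p.1| <= Num.min p.1 (T - p.1) / 2.
  by rewrite (le_trans _ qp)// [leRHS]/Num.norm /= le_max lexx.
have := @ge_min _ R p.1 p.1 (T - p.1); rewrite lexx /= => h1.
have : Num.min p.1 (T - p.1) <= T - p.1 by rewrite ge_min lexx orbT.
by rewrite ler_norml; move: h1; set m := Num.min _ _; lra.
Qed.

Lemma nbhs_cylinder p : cylinder T p -> nbhs p (cylinder T).
Proof.
move=> /cylinder_ball[r r0 hr]; suff : \forall q \near p, cylinder T q by [].
apply/nbhs_normP; exists r => // q.
by rewrite /ball_ /= distrC => /ltW /hr.
Qed.

Lemma ueps_bounded e p : 0 < e <= 1 -> cylinderT T p -> `|ueps e p| <= M.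
Proof.
case: p => t x e01 /andP[/= t0 _]; have /andP[e0 _] := e01.
exact: (game_value_bounded e01 (hu e0) uTM).
Qed.

Let Nueps_bounded e p : 0 < e <= 1 -> cylinderT T p -> `|- ueps e p| <= M.
Proof. by rewrite normrN; exact: ueps_bounded. Qed.

Lemma upper_limit_usc : usc_on (cylinderT T) upper_limit.
Proof. exact: (relaxed_sup_usc ueps_bounded). Qed.

Lemma lower_limit_lsc : lsc_on (cylinderT T) lower_limit.
Proof.
move=> p Tp a; rewrite ltrNr => h.
have := relaxed_sup_usc Nueps_bounded Tp h.
by apply: filterS => q hq; rewrite /lower_limit ltrNr; exact: hq.
Qed.

(** At a local maximum of the difference of a relaxed limit and [phi], the sum
    of [phi], of the squared distance and of a constant lies above [f e] near
    [p] and touches it up to [e ^ 3], for arbitrarily small [e]. *)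
Let touching (f : R -> R * 'rV[R]_N -> R) phi p :
  (forall e p, 0 < e <= 1 -> cylinderT T p -> `|f e p| <= M) ->
  (forall q, cylinder T q -> {for q, continuous phi}) -> cylinder T p ->
  (\forall q \near p, relaxed_sup T f q - phi q <= relaxed_sup T f p - phi p) ->
  exists2 rho : R, 0 < rho & forall r : R, 0 < r -> exists e q m,
    [/\ 0 < e < r, `|q - p| < r,
       (forall z, `|z - p| < rho -> cylinder T z /\
          f e z <= phi z + sqdist p z + m) &
       phi q + sqdist p q + m - e ^+ 3 <= f e q].
Proof.
move=> fM cphi Tp /nbhs_normP[r1 /= r10 hr1].
have [r2 r20 hr2] := cylinder_ball Tp.
set rho := Num.min (r1 / 2) r2.
have rho0 : 0 < rho by rewrite lt_min r20 divr_gt0.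
have [rho1 rho2] : rho <= r1 / 2 /\ rho <= r2 by rewrite !ge_min !lexx orbT.
exists rho => // r' r'0.
have cyl q : `|q - p| <= rho -> cylinder T q by move=> /le_trans/(_ rho2)/hr2.
have [||e [q [m [er qr hz hq]]]] :=
  relaxed_sup_test fM rho0 cyl (phi := phi) _ _ r'0.
- by move=> q /cyl Tq; exact: cphi.
- move=> q qr; apply: hr1; rewrite /ball_ /= distrC.
  by rewrite (le_lt_trans qr)//; lra.
exists e, q, m; split=> // z /ltW zr; split; [exact: cyl|exact: hz].
Qed.

(** Otherwise every round that Carol answers well would decrease the test
    function by a multiple of its duration, hence of [e ^ 2], while the test
    function touches the value function up to [e ^ 3]. *)
Lemma upper_limit_subsolution : subsolution T v upper_limit.
Proof.
split=> [|phi C2 p Tp pmax].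
  exact: usc_on_sub cylinderW upper_limit_usc.
rewrite leNgt; apply/negP => neg.
have [rho rho0 htouch] := touching ueps_bounded (C2_continuous C2) Tp pmax.
have sd := strict_diff_add_sqdist (C2_strict_diff C2 (nbhs_cylinder Tp)).
have neg' : dt phi p + v p.2 * enorm (grad phi p) < 0 by lra.
have [c [r [c0 r0 cons]]] := consistency_le L0 vL sd neg' rho0.
have m0 : 0 < Num.min (Num.min r rho) (Num.min 1 c) by rewrite !lt_min r0 rho0 ltr01.
have [e [[t x] [m [/andP[e0]]]]] := htouch _ m0.
rewrite !lt_min => /andP[/andP[er _] /andP[e1 ec]] /andP[/andP[qr qrho] _] hz hq.
have e01 : 0 < e <= 1 by rewrite e0 ltW.
have [Tq _] := hz _ qrho.
have : ueps e (t, x) <= phi (t, x) + sqdist p (t, x) + m - c * e ^+ 2.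
  apply: (game_value_le e01 (hu e0) uTM Tq) => xP mP.
  have [xC mC [nC dC]] := cons _ _ _ (introT andP (conj e0 er)) qr _ mP.
  exists xC => //; have [_ h] := hz _ nC; apply: (le_trans h).
  have : c * e ^+ 2 <= c * duration v e x xP xC.
    by rewrite ler_wpM2l ?(ltW c0)// duration_ge.
  by move: dC => /=; lra.
have : e * e ^+ 2 < c * e ^+ 2 by rewrite ltr_pM2r// exprn_gt0.
by move: hq; rewrite (exprS e 2); lra.
Qed.

Lemma lower_limit_supersolution : supersolution T v lower_limit.
Proof.
split=> [|phi C2 p Tp pmin].
  exact: lsc_on_sub cylinderW lower_limit_lsc.
rewrite leNgt; apply/negP => pos.
have cN q : cylinder T q -> {for q, continuous (fun q => - phi q)}.
  by move=> Tq; apply: continuousN; exact: C2_continuous C2 _ Tq.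
have [|rho rho0 htouch] := touching Nueps_bounded cN Tp.
  by apply: filterS pmin => q; rewrite /lower_limit; lra.
have sd := strict_diffN (strict_diff_add_sqdist (strict_diffN
  (C2_strict_diff C2 (nbhs_cylinder Tp)))).
rewrite !opprK in sd.
have pos' : 0 < dt phi p + v p.2 * enorm (grad phi p) by lra.
have [c [r [c0 r0 cons]]] := consistency_ge L0 vL sd pos' rho0.
have m0 : 0 < Num.min (Num.min r rho) (Num.min 1 c) by rewrite !lt_min r0 rho0 ltr01.
have [e [[t x] [m [/andP[e0]]]]] := htouch _ m0.
rewrite !lt_min => /andP[/andP[er _] /andP[e1 ec]] /andP[/andP[qr qrho] _] hz hq.
have e01 : 0 < e <= 1 by rewrite e0 ltW.
have [Tq _] := hz _ qrho.
have : phi (t, x) - sqdist p (t, x) - m + c * e ^+ 2 <= ueps e (t, x).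
  apply: (game_value_ge e01 (hu e0) uTM Tq).
  have [xP mP hxP] := cons _ _ _ (introT andP (conj e0 er)) qr.
  exists xP => // xC mC; have [nC dC] := hxP _ mC; have [_ h] := hz _ nC.
  have : c * e ^+ 2 <= c * duration v e x xP xC.
    by rewrite ler_wpM2l ?(ltW c0)// duration_ge.
  by move: dC h => /=; lra.
have : e * e ^+ 2 < c * e ^+ 2 by rewrite ltr_pM2r// exprn_gt0.
by move: hq; rewrite (exprS e 2); lra.
Qed.

Lemma cylinderT_terminal x : 0 < T -> cylinderT T (T, x).
Proof. by rewrite /cylinderT /= => ->/=. Qed.

Lemma upper_limit_terminal x : 0 < T -> upper_limit (T, x) <= uT x.
Proof.
move=> T0; apply/ler_addgt0Pr => eta eta0.
have [d d0 hd] := terminal_convergence L0 Lu0 vL uTL uTM x hu eta0.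
apply: (relaxed_sup_le ueps_bounded (cylinderT_terminal x T0) d0) => e q ed qd Tq.
by have := hd e q ed qd Tq; rewrite ler_norml; lra.
Qed.

Lemma lower_limit_terminal x : 0 < T -> uT x <= lower_limit (T, x).
Proof.
move=> T0; apply/ler_addgt0Pr => eta eta0; rewrite -lerBlDr lerNr opprB.
have [d d0 hd] := terminal_convergence L0 Lu0 vL uTL uTM x hu eta0.
apply: (relaxed_sup_le Nueps_bounded (cylinderT_terminal x T0) d0) => e q ed qd Tq.
by have := hd e q ed qd Tq; rewrite ler_norml; lra.
Qed.

Lemma lower_le_upper p : cylinderT T p -> lower_limit p <= upper_limit p.
Proof.
move=> Tp; rewrite leNgt; apply/negP => h.
pose a := (upper_limit p + lower_limit p) / 2.
have Ua : relaxed_sup T ueps p < a by rewrite /a; move: h; rewrite /upper_limit; lra.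
have Va : relaxed_sup T (fun e q => - ueps e q) p < - a.
  by rewrite /a; move: h; rewrite {2}/lower_limit /lower_limit; lra.
pose b := (a + relaxed_sup T ueps p) / 2.
have Ub : relaxed_sup T ueps p < b by rewrite /b; lra.
have [d1 d10 h1] := relaxed_sup_lt ueps_bounded Tp Ub.
have [d2 d20 h2] := relaxed_sup_lt Nueps_bounded Tp Va.
set d := Num.min d1 d2; have d0 : 0 < d by rewrite lt_min d10.
have [dd1 dd2] : d <= d1 /\ d <= d2 by rewrite !ge_min !lexx orbT.
have pp r : 0 < r -> `|p - p| < r by rewrite subrr normr0.
have := h1 (d / 2) p _ (pp _ d10) Tp; have := h2 (d / 2) p _ (pp _ d20) Tp.
have e1 : 0 < d / 2 < d1 by rewrite divr_gt0//=; lra.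
have e2 : 0 < d / 2 < d2 by rewrite divr_gt0//=; lra.
by move=> /(_ e2) + /(_ e1); rewrite /b; lra.
Qed.

(** Where the two relaxed limits agree, the family converges, uniformly on
    compact sets. *)
Lemma uniform_convergence u : {within cylinderT T, continuous u} ->
  (forall p, cylinderT T p -> upper_limit p <= u p) ->
  (forall p, cylinderT T p -> u p <= lower_limit p) ->
  forall K : set (R * 'rV[R]_N), compact K -> K `<=` cylinderT T ->
    forall eta : R, 0 < eta ->
      \forall e \near 0^'+, forall p, K p -> `|ueps e p - u p| < eta.
Proof.
move=> cu Uu uV K cK KT eta eta0.
have [|d d0 hd] := compact_uniform (P := fun e p => cylinderT T p ->
    `|ueps e p - u p| < eta) cK.
  move=> p Kp; have Tp := KT _ Kp; have e4 : 0 < eta / 4 by rewrite divr_gt0.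
  have U1 : relaxed_sup T ueps p < u p + eta / 4.
    by rewrite (le_lt_trans (Uu _ Tp))// ltrDl.
  have V1 : relaxed_sup T (fun e q => - ueps e q) p < - u p + eta / 4.
    by have := uV _ Tp; rewrite /lower_limit; lra.
  have [d1 d10 hd1] := relaxed_sup_lt ueps_bounded Tp U1.
  have [d2 d20 hd2] := relaxed_sup_lt Nueps_bounded Tp V1.
  have : \forall q \near p, cylinderT T q -> `|u p - u q| < eta / 4.
    have := (@subspace_continuousP _ _ _ u).1 cu p Tp.
    by move=> /cvgrPdist_lt/(_ _ e4).
  move=> /nbhs_normP[d3 /= d30 hd3].
  exists (Num.min d1 (Num.min d2 d3)); first by rewrite !lt_min d10 d20.
  move=> e q /andP[e0]; rewrite !lt_min => /and3P[ed1 ed2 _] /and3P[qd1 qd2 qd3] Tq.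
  have := hd1 e q (introT andP (conj e0 ed1)) qd1 Tq.
  have := hd2 e q (introT andP (conj e0 ed2)) qd2 Tq.
  have : ball_ Num.norm p d3 q by rewrite /ball_ /= distrC.
  by move=> /hd3/(_ Tq); rewrite !ltr_norml; lra.
near=> e => p Kp; apply: hd => //; last exact: KT.
apply/andP; split; first by near: e; exact: nbhs_right_gt.
by near: e; exact: nbhs_right_lt.
Unshelve. all: by end_near.
Qed.

End RelaxedLimitsOfGame.

(** * Maxima of semicontinuous functions and polynomial test functions *)

Section UpperSemicontinuity.
Context {R : realType} {X : normedModType R}.
Implicit Types (K : set X) (f g : X -> R).

(** Upper semicontinuity of [f] restricted to [K], in metric form. *)
Definition usc_in K f : Prop := forall x, K x -> forall e : R, 0 < e ->
  exists2 d : R, 0 < d & forall y, K y -> `|y - x| < d -> f y < f x + e.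

Lemma usc_in_add K f g : usc_in K f -> usc_in K g ->
  usc_in K (fun x => f x + g x).
Proof.
move=> uf ug x Kx e e0; have e2 : 0 < e / 2 by rewrite divr_gt0.
have [d1 d10 h1] := uf x Kx _ e2; have [d2 d20 h2] := ug x Kx _ e2.
exists (Num.min d1 d2); first by rewrite lt_min d10.
move=> y Ky; rewrite lt_min => /andP[y1 y2].
by have := h1 y Ky y1; have := h2 y Ky y2; lra.
Qed.

Lemma usc_in_continuous K f : continuous f -> usc_in K f.
Proof.
move=> cf x _ e e0; have /cvgrPdist_lt/(_ _ e0)/nbhs_normP[d /= d0 hd] := cf x.
exists d => // y _ yx; have /hd /= : ball_ Num.norm x d y.
  by rewrite /ball_ /= distrC.
by rewrite ltr_norml; lra.
Qed.

Lemma usc_in_max K f : compact K -> K !=set0 -> usc_in K f ->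
  exists2 x, K x & forall y, K y -> f y <= f x.
Proof.
move=> cK [x0 Kx0] uf.
have [B hB] : exists B : R, forall y, K y -> f y <= B.
  have [|d d0 hd] := compact_uniform (P := fun e y => K y -> f y <= e^-1) cK.
    move=> x Kx; have [d d0 hd] := uf x Kx 1 ltr01.
    have f1 : 0 < `|f x| + 1 by rewrite ltr_wpDl.
    exists (Num.min d (`|f x| + 1)^-1); first by rewrite lt_min d0 invr_gt0.
    move=> e y /andP[e0]; rewrite !lt_min => /andP[_ ef] /andP[yd _] Ky.
    rewrite (le_trans (ltW (hd y Ky yd)))//.
    apply: le_trans (_ : `|f x| + 1 <= _); first by rewrite lerD2r ler_norm.
    by rewrite -[leLHS]invrK lef_pV2 ?posrE ?invr_gt0// ltW.
  exists (d / 2)^-1 => y Ky; apply: hd => //.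
  by rewrite divr_gt0//= ltr_pdivrMr// mulr_natr mulr2n ltrDl.
apply: contrapT => h; set S := f @` K.
have hS : has_sup S by split; [exists (f x0), x0|exists B => _ [y Ky <-]; exact: hB].
have lts x : K x -> f x < sup S.
  move=> Kx; rewrite lt_neqAle; apply/andP; split; last first.
    by apply: ub_le_sup; [case: hS|exists x].
  apply/eqP => fx; apply: h; exists x => // y Ky; rewrite fx.
  by apply: ub_le_sup; [case: hS|exists y].
have [|d d0 hd] := compact_uniform (P := fun e y => K y -> f y <= sup S - e) cK.
  move=> x Kx; have fs := lts x Kx.
  have e0 : 0 < (sup S - f x) / 2 by rewrite divr_gt0// subr_gt0.
  have [d d0 hd] := uf x Kx _ e0.
  exists (Num.min d ((sup S - f x) / 2)); first by rewrite lt_min d0.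
  move=> e y /andP[_]; rewrite !lt_min => /andP[_ ed] /andP[yd _] Ky.
  by have := hd y Ky yd; lra.
have d2 : 0 < d / 2 by rewrite divr_gt0.
have : sup S <= sup S - d / 2.
  apply: ge_sup; first by case: hS.
  move=> _ [y Ky <-]; apply: hd => //.
  by rewrite d2 ltr_pdivrMr// mulr_natr mulr2n ltrDl.
by move: d2; lra.
Qed.

End UpperSemicontinuity.

Section PolynomialTestFunctions.
Context {R : realType} {N : nat}.
Implicit Types (f g : R * 'rV[R]_N -> R) (p d : R * 'rV[R]_N).

(** Polynomial functions of time and of the space coordinates; the class is
    stable under directional derivatives. *)
Inductive poly_fun : (R * 'rV[R]_N -> R) -> Prop :=
  | poly_cst c : poly_fun (fun=> c)
  | poly_time : poly_fun (fun p => p.1)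
  | poly_coord i : poly_fun (fun p => p.2 0 i)
  | poly_add f g : poly_fun f -> poly_fun g -> poly_fun (fun p => f p + g p)
  | poly_mul f g : poly_fun f -> poly_fun g -> poly_fun (fun p => f p * g p).

Lemma is_derive_lin (V : normedModType R) (f : V -> R) (p d : V) :
  (forall h : R, f (h *: d + p) = h * f d + f p) -> is_derive p d f (f d).
Proof.
move=> lf.
have h : (fun h : R => h^-1 *: ((f \o shift p) (h *: d) - f p)) @ 0^' --> f d.
  apply: cvg_near_cst; near=> h; rewrite /= lf addrK scalerA mulVf ?mul1r//.
    exact: scale1r.
  by near: h; exact: nbhs_dnbhs_neq.
split; first by apply/cvg_ex; exists (f d).
exact: (cvg_lim _ h).
Unshelve. all: by end_near.
Qed.

Lemma is_derive_time p d : is_derive p d (fun q : R * 'rV[R]_N => q.1) d.1.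
Proof. exact: (@is_derive_lin _ (fun q : R * 'rV[R]_N => q.1)). Qed.

Lemma is_derive_coord i p d :
  is_derive p d (fun q : R * 'rV[R]_N => q.2 0 i) (d.2 0 i).
Proof.
by apply: (@is_derive_lin _ (fun q : R * 'rV[R]_N => q.2 0 i)) => h /=; rewrite !mxE.
Qed.

Lemma is_derive_add f g p d df dg : is_derive p d f df -> is_derive p d g dg ->
  is_derive p d (fun q => f q + g q) (df + dg).
Proof. by move=> ? ?; exact: is_deriveD. Qed.

Lemma is_derive_mul f g p d df dg : is_derive p d f df -> is_derive p d g dg ->
  is_derive p d (fun q => f q * g q) (f p * dg + g p * df).
Proof. by move=> ? ?; exact: is_deriveM. Qed.

Lemma is_derive_exp f n p d df : is_derive p d f df ->
  is_derive p d (fun q => f q ^+ n) (n%:R * f p ^+ n.-1 * df).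
Proof.
move=> hf; rewrite (_ : (fun q => f q ^+ n) = f ^+ n); first exact: is_deriveX.
by rewrite exprfctE.
Qed.

Lemma poly_fun_differentiable f p : poly_fun f -> differentiable f p.
Proof.
elim=> [c||i|{}f g _ df _ dg|{}f g _ df _ dg].
- exact: differentiable_cst.
- by apply: linear_differentiable => q; exact: cvg_fst.
- apply: (@differentiable_comp _ _ _ _ snd (fun x : 'rV[R]_N => x 0 i)).
    by apply: linear_differentiable => q; exact: cvg_snd.
  exact: differentiable_coord.
- exact: differentiableD.
- exact: differentiableM.
Qed.

Lemma poly_fun_continuous f : poly_fun f -> continuous f.
Proof.
by move=> pf p; apply: differentiable_continuous; exact: poly_fun_differentiable.
Qed.

Lemma poly_fun_derive f d : poly_fun f -> poly_fun ('D_d f).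
Proof.
have D f' p : poly_fun f' -> is_derive p d f' ('D_d f' p).
  by move=> pf; apply/derivableP/diff_derivable; exact: poly_fun_differentiable.
elim=> [c||i|{}f g pf IHf pg IHg|{}f g pf IHf pg IHg].
- rewrite (_ : 'D_d _ = fun=> 0); first exact: poly_cst.
  by apply/funext => p; exact: derive_cst.
- rewrite (_ : 'D_d _ = fun=> d.1); first exact: poly_cst.
  by apply/funext => p; have [_ ->] := is_derive_time p d.
- rewrite (_ : 'D_d _ = fun=> d.2 0 i); first exact: poly_cst.
  by apply/funext => p; have [_ ->] := is_derive_coord i p d.
- rewrite (_ : 'D_d _ = fun p => 'D_d f p + 'D_d g p); first exact: poly_add.
  apply/funext => p.
  by have [_ ->] := is_derive_add (D f p pf) (D g p pg).
- rewrite (_ : 'D_d _ = fun p => f p * 'D_d g p + g p * 'D_d f p).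
    by apply: poly_add; exact: poly_mul.
  apply/funext => p.
  by have [_ ->] := is_derive_mul (D f p pf) (D g p pg).
Qed.

Lemma poly_fun_C2 (A : set (R * 'rV[R]_N)) f : poly_fun f -> C2_on A f.
Proof.
move=> pf p _; split=> [|d]; first exact: poly_fun_differentiable.
split=> [|d']; first exact/poly_fun_differentiable/poly_fun_derive.
exact/poly_fun_continuous/poly_fun_derive/poly_fun_derive.
Qed.

Lemma poly_fun_exp f n : poly_fun f -> poly_fun (fun p => f p ^+ n).
Proof.
move=> pf; elim: n => [|n IH]; first exact: poly_cst.
rewrite (_ : (fun p => _) = fun p => f p * f p ^+ n); first exact: poly_mul.
by apply/funext => p; rewrite exprS.
Qed.

Lemma poly_fun_dist (x0 : 'rV[R]_N) :
  poly_fun (fun p => dot (p.2 - x0) (p.2 - x0)).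
Proof.
rewrite (_ : (fun p => _) = (fun p => \sum_(i < N)
    (p.2 0 i + - x0 0 i) * (p.2 0 i + - x0 0 i))); last first.
  by apply/funext => p; apply: eq_bigr => i _; rewrite !mxE.
elim: (index_enum 'I_N) => [|i s IH].
  rewrite (_ : (fun p => _) = fun=> 0); first exact: poly_cst.
  by apply/funext => p; rewrite big_nil.
rewrite (_ : (fun p => _) = fun p => (p.2 0 i + - x0 0 i) * (p.2 0 i + - x0 0 i) +
    \sum_(j <- s) (p.2 0 j + - x0 0 j) * (p.2 0 j + - x0 0 j)); last first.
  by apply/funext => p; rewrite big_cons.
have pi : poly_fun (fun p => p.2 0 i + - x0 0 i).
  exact: poly_add (poly_coord i) (poly_cst (- x0 0 i)).
by apply: poly_add => //; exact: poly_mul.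
Qed.

Lemma is_derive_dist (x0 : 'rV[R]_N) p d :
  is_derive p d (fun q => dot (q.2 - x0) (q.2 - x0)) (2 * dot (p.2 - x0) d.2).
Proof.
rewrite (_ : (fun q => _) = \sum_(i < N)
    (fun q : R * 'rV[R]_N => (q.2 0 i + - x0 0 i) * (q.2 0 i + - x0 0 i))); last first.
  by apply/funext => q; rewrite fct_sumE; apply: eq_bigr => i _; rewrite !mxE.
have D i : is_derive p d (fun q : R * 'rV[R]_N => q.2 0 i + - x0 0 i) (d.2 0 i).
  rewrite -[X in is_derive _ _ _ X]addr0.
  exact: is_derive_add (is_derive_coord i p d) (is_derive_cst _ _ _).
have h := is_derive_sum (fun i => is_derive_mul (D i) (D i)).
apply: (is_derive_eq h); rewrite mulr_sumr; apply: eq_bigr => i _; rewrite !mxE; ring.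
Qed.

(** The time derivative and the gradient are read off the directional
    derivatives. *)
Lemma dt_grad_eq f p (a : R) (y : 'rV[R]_N) :
  (forall d, is_derive p d f (a * d.1 + dot y d.2)) -> dt f p = a /\ grad f p = y.
Proof.
move=> hf; split.
  rewrite /dt; have [_ ->] := hf (1, 0).
  by rewrite /= mulr1 -(scale0r 0) dotZr mul0r addr0.
apply/rowP => i; rewrite mxE; have [_ ->] := hf (0, delta_mx 0 i).
rewrite /= mulr0 add0r /dot (bigD1 i)//= !mxE !eqxx mulr1 big1 ?addr0// => j ji.
by rewrite !mxE (negPf ji) andbF mulr0.
Qed.

End PolynomialTestFunctions.

(** * The comparison principle *)

Section Doubling.
Context {R : realType} {N : nat}.
Let X := (R * 'rV[R]_N)%type.
Implicit Types (p q : X) (K G : set X) (f g : X -> R).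

Lemma sqdist_continuous : continuous (fun z : X * X => sqdist z.1 z.2).
Proof.
have c1 : continuous (fun z : X * X => z.2.1 - z.1.1).
  move=> z; apply: cvgB.
    exact: (cvg_comp _ _ cvg_snd cvg_fst).
  exact: (cvg_comp _ _ cvg_fst cvg_fst).
have c2 i : continuous (fun z : X * X => (z.2.2 - z.1.2) 0 i).
  move=> z; apply: (@continuous_comp _ _ _ (fun z : X * X => z.2.2 - z.1.2)
    (fun x : 'rV[R]_N => x 0 i)); last exact: coord_continuous.
  apply: cvgB.
    exact: (cvg_comp _ _ cvg_snd cvg_snd).
  exact: (cvg_comp _ _ cvg_fst cvg_snd).
move=> z; apply: cvgD; first by apply: cvgM; exact: c1.
rewrite /dot; apply: cvg_big => [|i _]; first exact: add_continuous.
by apply: cvgM; exact: c2.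
Qed.

Lemma sqdistC p q : sqdist p q = sqdist q p.
Proof.
by rewrite /sqdist -(opprB p.1 q.1) sqrrN -(opprB p.2 q.2) dotNl dotNr opprK.
Qed.

Lemma sqdistxx p : sqdist p p = 0.
Proof. by rewrite /sqdist !subrr expr0n /= -(scale0r 0) dotZl mul0r addr0. Qed.

Lemma usc_in_fst K f : usc_in K f -> usc_in (K `*` K) (fun z : X * X => f z.1).
Proof.
move=> uf z [Kz _] e e0; have [d d0 hd] := uf _ Kz _ e0; exists d => // y [Ky _] yz.
apply: hd => //; apply: le_lt_trans yz.
by rewrite [leRHS]/Num.norm /= le_max lexx.
Qed.

Lemma usc_in_snd K f : usc_in K f -> usc_in (K `*` K) (fun z : X * X => f z.2).
Proof.
move=> uf z [_ Kz] e e0; have [d d0 hd] := uf _ Kz _ e0; exists d => // y [_ Ky] yz.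
apply: hd => //; apply: le_lt_trans yz.
by rewrite [leRHS]/Num.norm /= le_max lexx orbT.
Qed.

(** Doubling of variables: [f p + g p] is replaced by
    [f p + g q - a * |p - q|^2]. At a maximum the penalty is small and both
    points avoid the complement of [G], where [f + g] is nonpositive. *)
Lemma doubling_of_variables K G f g p0 : compact K ->
  usc_in K f -> usc_in K g -> K p0 -> 0 < f p0 + g p0 ->
  (forall p, K p -> ~ G p -> f p + g p <= 0) ->
  (forall p, G p -> exists2 d : R, 0 < d & forall q, `|q - p| < d -> G q) ->
  forall k : R, 0 < k -> exists (a : R) p q,
    [/\ 0 < a, K p /\ G p, K q /\ G q, a * sqdist p q <= k &
      forall p' q', K p' -> K q' ->
        f p' + g q' - a * sqdist p' q' <= f p + g q - a * sqdist p q].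
Proof.
move=> cK uf ug Kp0 fg0 bad oG k k0.
have K0 : K !=set0 by exists p0.
have [ps Kps hps] := usc_in_max cK K0 (usc_in_add uf ug).
have [pf Kpf hpf] := usc_in_max cK K0 uf.
have [pg Kpg hpg] := usc_in_max cK K0 ug.
set D := f ps + g ps in hps.
have D0 : 0 < D by rewrite (lt_le_trans fg0)// hps.
have [|d d0 hd] := compact_uniform (P := fun e p => K p -> forall q, K q ->
    `|q - p| < e -> f p + g q < D + k /\ (D <= f p + g q -> G p /\ G q)) cK.
  move=> p Kp; set e := Num.min k D.
  have e0 : 0 < e by rewrite lt_min k0.
  have [ek eD] : e <= k /\ e <= D by rewrite !ge_min !lexx orbT.
  have e2 : 0 < e / 2 by rewrite divr_gt0.
  have [d1 d10 h1] := uf p Kp _ e2; have [d2 d20 h2] := ug p Kp _ e2.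
  have [d3 d30 h3] : exists2 d3 : R, 0 < d3 & G p -> forall q, `|q - p| < d3 -> G q.
    have [Gp|nGp] := pselect (G p); last by exists 1.
    by have [d3 d30 h3] := oG p Gp; exists d3.
  exists (Num.min d1 (Num.min d2 d3) / 2).
    by rewrite divr_gt0// !lt_min d10 d20.
  have [m1 [m2 m3]] : [/\ Num.min d1 (Num.min d2 d3) <= d1,
      Num.min d1 (Num.min d2 d3) <= d2 & Num.min d1 (Num.min d2 d3) <= d3].
    by rewrite !ge_min !lexx !orbT.
  set m := Num.min _ _ in m1 m2 m3 *.
  move=> r q /andP[r0 rm] qp Kq z Kz zq.
  have zp : `|z - p| < m by have := ler_distD q z p; lra.
  have qp' : `|q - p| < m by have := normr_ge0 (q - p); lra.
  have fq := h1 q Kq (lt_le_trans qp' m1); have gz := h2 z Kz (lt_le_trans zp m2).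
  have fgp := hps p Kp; split; first by lra.
  move=> Dle; have Gp : G p.
    by apply: contrapT => /(bad _ Kp) ?; lra.
  by split; apply: h3 => //; apply: lt_le_trans m3.
have dd : 0 < (d / 2) ^+ 2 by rewrite exprn_gt0// divr_gt0.
set C := f pf + g pg - D.
have C0 : 0 <= C by have := hpf _ Kps; have := hpg _ Kps; rewrite /C /D; lra.
set a := (C + 1) / (d / 2) ^+ 2.
have a0 : 0 < a by rewrite divr_gt0//; lra.
have aE : a * (d / 2) ^+ 2 = C + 1 by rewrite /a divfK// gt_eqF.
have usc : usc_in (K `*` K) (fun z : X * X => f z.1 + g z.2 + - a * sqdist z.1 z.2).
  apply: usc_in_add; first by apply: usc_in_add; [exact: usc_in_fst|exact: usc_in_snd].
  apply: usc_in_continuous => z; apply: cvgM; first exact: cvg_cst.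
  exact: sqdist_continuous.
have [|[p q] /= [Kp Kq] hmax] := usc_in_max (compact_setX cK cK) _ usc.
  by exists (p0, p0).
have := hmax (ps, ps) (conj Kps Kps); rewrite /= sqdistxx mulr0 addr0 -/D => hD.
have fle := hpf _ Kp; have gle := hpg _ Kq.
have sqd : sqdist p q < (d / 2) ^+ 2.
  by rewrite -(ltr_pM2l a0) aE; move: hD; rewrite /C; lra.
have qp : `|q - p| < d / 2.
  have := le_lt_trans (normr_le_sqdist p q) sqd.
  by rewrite ltr_pXn2r ?nnegrE//; rewrite ltW// divr_gt0.
have [|FD GG] := hd (d / 2) p _ Kp Kp q Kq qp.
  by rewrite divr_gt0//= ltr_pdivrMr// mulr_natr mulr2n ltrDl.
have aq : 0 <= a * sqdist p q by rewrite mulr_ge0 ?sqdist_ge0// ltW.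
have [|Gp Gq] := GG; first by lra.
exists a, p, q; split=> //; first by lra.
by move=> p' q' Kp' Kq'; have := hmax (p', q') (conj Kp' Kq'); rewrite /=; lra.
Qed.

End Doubling.

Section Barrier.
Context {R : realType} {N : nat} (T : R) (x0 : 'rV[R]_N) (m : nat).
Implicit Types p q d : R * 'rV[R]_N.

(** For [m] large, the sublevel sets of this function shrink backwards in time
    faster than the characteristics of the equation can move. *)
Definition cone p : R :=
  (1 + dot (p.2 - x0) (p.2 - x0)) * (T + 1 - p.1) ^+ m.

Lemma poly_fun_cone : poly_fun cone.
Proof.
rewrite (_ : cone = fun p => (1 + dot (p.2 - x0) (p.2 - x0)) *
  (T + 1 + -1 * p.1) ^+ m).
  apply: poly_mul; first by apply: poly_add (poly_cst 1) (poly_fun_dist x0).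
  apply: poly_fun_exp; apply: poly_add (poly_cst (T + 1)) _.
  exact: poly_mul (poly_cst (-1)) poly_time.
by apply/funext => p; rewrite mulN1r.
Qed.

Hypothesis m0 : (0 < m)%N.

Lemma is_derive_cone p d : is_derive p d cone ((T + 1 - p.1) ^+ m.-1 *
  ((T + 1 - p.1) * (2 * dot (p.2 - x0) d.2) -
   (1 + dot (p.2 - x0) (p.2 - x0)) * m%:R * d.1)).
Proof.
have D1 : is_derive p d (fun q : R * 'rV[R]_N => T + 1 + -1 * q.1)
    (0 + (-1 * d.1 + p.1 * 0)).
  apply: is_derive_add (is_derive_cst (T + 1) p d) _.
  exact: is_derive_mul (is_derive_cst (-1 : R) p d) (is_derive_time p d).
have D2 : is_derive p d (fun q : R * 'rV[R]_N => 1 + dot (q.2 - x0) (q.2 - x0))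
    (0 + 2 * dot (p.2 - x0) d.2).
  exact: is_derive_add (is_derive_cst (1 : R) p d) (is_derive_dist x0 p d).
rewrite (_ : cone = fun p => (1 + dot (p.2 - x0) (p.2 - x0)) *
  (T + 1 + -1 * p.1) ^+ m); last by apply/funext => q; rewrite mulN1r.
apply: (is_derive_eq (is_derive_mul D2 (is_derive_exp m D1))).
rewrite mulN1r; set s := T + 1 - p.1.
have -> : s ^+ m = s * s ^+ m.-1 by rewrite -exprS prednK.
ring.
Qed.

Lemma poly_fun_sqdist q : poly_fun (sqdist q).
Proof.
rewrite (_ : sqdist q = fun p => (p.1 + - q.1) ^+ 2 + dot (p.2 - q.2) (p.2 - q.2)) //.
apply: poly_add; last exact: poly_fun_dist.
by apply: poly_fun_exp; apply: poly_add poly_time (poly_cst (- q.1)).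
Qed.

Lemma is_derive_sqdist q p d : is_derive p d (sqdist q)
  (2 * ((p.1 - q.1) * d.1 + dot (p.2 - q.2) d.2)).
Proof.
have D1 : is_derive p d (fun z : R * 'rV[R]_N => z.1 + - q.1) (d.1 + 0).
  exact: is_derive_add (is_derive_time p d) (is_derive_cst _ _ _).
have := is_derive_add (is_derive_exp 2 D1) (is_derive_dist q.2 p d).
by move=> h; apply: (is_derive_eq h); rewrite /= expr1; ring.
Qed.

(** The two test functions of the doubling argument, with their derivatives. *)
Lemma upper_test (a c : R) (n : nat) q p
    (P := c * n%:R * cone p ^+ n.-1 * (T + 1 - p.1) ^+ m.-1)
    (phi := fun z => a * sqdist q z + c * cone z ^+ n) :
  [/\ C2_on (cylinder T) phi,
      dt phi p = 2 * a * (p.1 - q.1) -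
        P * ((1 + dot (p.2 - x0) (p.2 - x0)) * m%:R) &
      grad phi p = (2 * a) *: (p.2 - q.2) +
        (2 * P * (T + 1 - p.1)) *: (p.2 - x0)].
Proof.
have pphi : poly_fun phi.
  apply: poly_add; apply: poly_mul; try exact: poly_cst.
    exact: poly_fun_sqdist.
  by apply: poly_fun_exp; exact: poly_fun_cone.
have [] := @dt_grad_eq _ _ phi p (2 * a * (p.1 - q.1) -
        P * ((1 + dot (p.2 - x0) (p.2 - x0)) * m%:R)) ((2 * a) *: (p.2 - q.2) +
        (2 * P * (T + 1 - p.1)) *: (p.2 - x0)).
  move=> d.
  have h1 := is_derive_mul (is_derive_cst a p d) (is_derive_sqdist q p d).
  have h2 := is_derive_mul (is_derive_cst c p d) (is_derive_exp n (is_derive_cone p d)).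
  apply: (is_derive_eq (is_derive_add h1 h2)).
  by rewrite (dotDl (_ *: (p.2 - q.2))) !dotZl /P /cst /=; ring.
by move=> -> ->; split=> //; exact: poly_fun_C2.
Qed.

Lemma lower_test (a : R) p q (phi := fun z => - a * sqdist p z) :
  [/\ C2_on (cylinder T) phi, dt phi q = 2 * a * (p.1 - q.1) &
      grad phi q = (2 * a) *: (p.2 - q.2)].
Proof.
have pphi : poly_fun phi.
  by apply: poly_mul; [exact: poly_cst|exact: poly_fun_sqdist].
have [] := @dt_grad_eq _ _ phi q (2 * a * (p.1 - q.1)) ((2 * a) *: (p.2 - q.2)).
  move=> d.
  apply: (is_derive_eq (is_derive_mul (is_derive_cst (- a) q d) (is_derive_sqdist p q d))).
  by rewrite dotZl -(opprB p.2 q.2) dotNl /cst /=; ring.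
by move=> -> ->; split=> //; exact: poly_fun_C2.
Qed.

Lemma cone_ge1 p : p.1 <= T -> 1 <= cone p.
Proof.
move=> pT; have := dotxx_ge0 (p.2 - x0) => d0.
rewrite -[leLHS]mulr1 ler_pM//; first by rewrite lerDl.
by rewrite exprn_ege1//; lra.
Qed.

(** The barrier is a strict supersolution for the speed [A * (1 + |x - x0|)]. *)
Lemma barrier_strict (A P : R) p (vp : R) : 0 <= A ->
  4 * A * (T + 1) + 1 <= m%:R -> 0 <= p.1 -> p.1 <= T -> 0 <= P ->
  `|vp| <= A * (1 + enorm (p.2 - x0)) ->
  P <= P * ((1 + dot (p.2 - x0) (p.2 - x0)) * m%:R) -
    `|vp| * enorm ((2 * P * (T + 1 - p.1)) *: (p.2 - x0)).
Proof.
move=> A0 Am p0 pT P0 vA; set s := T + 1 - p.1; have s0 : 0 <= s by rewrite /s; lra.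
have sT : s <= T + 1 by rewrite /s; lra.
have sP : 0 <= 2 * P * s by rewrite !mulr_ge0.
rewrite enormZ (ger0_norm sP) -sqr_enorm.
set r := enorm (p.2 - x0) in vA *; have r0 : 0 <= r := enorm_ge0 _.
have rr : 0 <= r ^+ 2 := sqr_ge0 r.
have h1 : `|vp| * (2 * P * s * r) <= A * (1 + r) * (2 * P * s * r).
  by rewrite ler_wpM2r// !mulr_ge0.
have h2 : P * (A * s) * (2 * r * (1 + r)) <= P * (A * s) * (4 * (1 + r ^+ 2)).
  rewrite ler_wpM2l ?mulr_ge0//.
  by have := sqr_ge0 (r - 1); lra.
have h3 : P * (4 * (1 + r ^+ 2)) * (A * s) <= P * (4 * (1 + r ^+ 2)) * (A * (T + 1)).
  by rewrite ler_wpM2l ?mulr_ge0 ?addr_ge0// ler_wpM2l.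
have h4 : P * (1 + r ^+ 2) * (4 * A * (T + 1) + 1) <= P * (1 + r ^+ 2) * m%:R.
  by rewrite ler_wpM2l ?mulr_ge0 ?addr_ge0.
have h5 : 0 <= P * r ^+ 2 by rewrite mulr_ge0.
lra.
Qed.

End Barrier.

Section Comparison.
Context {R : realType} {N : nat} (T L : R) (v : 'rV[R]_N -> R).
Hypotheses (T0 : 0 < T) (L0 : 0 < L).
Hypothesis vL : forall x y, `|v x - v y| <= L * `|x - y|.
Implicit Types p q : R * 'rV[R]_N.

Lemma usc_on_usc_in (K : set (R * 'rV[R]_N)) u : K `<=` cylinderT T ->
  usc_on (cylinderT T) u -> usc_in K u.
Proof.
move=> KT uu p Kp e e0.
have h : \forall q \near p, cylinderT T q -> u q < u p + e.
  by apply: uu; [exact: KT|rewrite ltrDl].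
move: h => /nbhs_normP[d /= d0 hd]; exists d => // q Kq qp.
by apply: hd; [rewrite /ball_ /= distrC|exact: KT].
Qed.

Lemma exprn_small (x e : R) : 0 <= x -> x < 1 -> 0 < e ->
  exists2 n : nat, (0 < n)%N & x ^+ n <= e.
Proof.
move=> x0 x1 e0; have : `|x| < 1 by rewrite ger0_norm.
move=> /cvg_expr/cvgrPdist_le/(_ _ e0)[n _ hn]; exists n.+1 => //.
by have := hn n.+1 (leqnSn n); rewrite /= sub0r normrN ger0_norm ?exprn_ge0.
Qed.

(** Comparison principle, without any growth condition: information travels at a
    speed that grows at most linearly, so the doubling of variables takes place
    in a compact sublevel set [K] of [cone], with a multiple [h] of a high power
    of [cone] that is small at the initial point and dominates [U - V] on the
    lateral boundary of [K]. *)
Lemma comparison U V :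
  usc_on (cylinderT T) U -> subsolution T v U ->
  lsc_on (cylinderT T) V -> supersolution T v V ->
  (forall x, U (T, x) <= V (T, x)) ->
  forall p, cylinderT T p -> U p <= V p.
Proof.
move=> uU [_ subU] lV [_ supV] UV [t0 x0] Tp0; rewrite leNgt; apply/negP => VU.
have /andP[/= t00 t0T] := Tp0.
have {}t0T : t0 < T.
  rewrite lt_neqAle t0T andbT; apply/eqP => tT; move: VU; rewrite tT.
  by rewrite ltNge UV.
set A := `|v x0| + L.
have A0 : 0 <= A by rewrite addr_ge0// ltW.
have vA y : `|v y| <= A * (1 + enorm (y - x0)).
  have := ler_normD (v y - v x0) (v x0); rewrite subrK.
  have := vL y x0.
  have : L * `|y - x0| <= L * enorm (y - x0).
    by rewrite ler_wpM2l ?normr_le_enorm// ltW.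
  have := mulr_ge0 (normr_ge0 (v x0)) (enorm_ge0 (y - x0)).
  have := enorm_ge0 (y - x0); rewrite /A; move: L0; lra.
(* large enough for barrier_strict to apply *)
pose m := (Num.bound (4 * A * (T + 1) + 1)).+1.
have mA : 4 * A * (T + 1) + 1 <= m%:R.
  have h : 0 <= 4 * A * (T + 1) + 1.
    by rewrite addr_ge0// !mulr_ge0//; move: T0; lra.
  by rewrite (le_trans (ltW (archi_boundP h)))// ler_nat.
have m0 : (0 < m)%N by [].
clearbody m.
pose rho := cone T x0 m.
have crho : continuous rho by apply: poly_fun_continuous; exact: poly_fun_cone.
(* every point of K at time t1 lies on the lateral boundary cone = rho1 *)
pose t1 := t0 / 2; have t10 : 0 < t1 by rewrite divr_gt0.
pose rho1 := (T + 1 - t1) ^+ m.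
have rho10 : 0 < rho1 by rewrite exprn_gt0// /t1; lra.
pose K : set (R * 'rV[R]_N) := [set p | t1 <= p.1 <= T /\ rho p <= rho1].
have KT : K `<=` cylinderT T.
  move=> p [/andP[p1 pT] _]; rewrite /cylinderT /= pT andbT.
  exact: lt_le_trans p1.
have rho_ge p : p.1 <= T -> dot (p.2 - x0) (p.2 - x0) + 1 <= rho p.
  move=> pT; rewrite /rho /cone addrC -[leLHS]mulr1 ler_wpM2l//.
    by rewrite addr_ge0// dotxx_ge0.
  by rewrite exprn_ege1//; lra.
have cK : compact K.
  apply: (@compact_closed_bounded _ _ K (t0, x0) (T + rho1)).
    have -> : K = (fun p : R * 'rV[R]_N => p.1) @^-1` `[t1, T]%classic `&`
        rho @^-1` [set y | y <= rho1].
      by apply/seteqP; split => p; rewrite /K /= in_itv.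
    apply: closedI.
      apply: preimage_closed; last exact: interval_closed.
      by move=> p _; exact: cvg_fst.
    by apply: preimage_closed; [move=> p _; exact: crho|exact: closed_le].
  move=> p [/andP[p1 pT] pr].
  have -> : `|p - (t0, x0)| = Num.max `|p.1 - t0| `|p.2 - x0| by [].
  rewrite ge_max; apply/andP; split.
    by rewrite ler_norml; move: t10 rho10; lra.
  have := rho_ge p pT; rewrite -sqr_enorm.
  have := normr_le_enorm (p.2 - x0); have := sqr_ge0 (enorm (p.2 - x0) - 1).
  by have := enorm_ge0 (p.2 - x0); move: T0; lra.
have rp0 : rho (t0, x0) = (T + 1 - t0) ^+ m.
  by rewrite /rho /cone /= subrr -(scale0r 0) dotZl mul0r addr0 mul1r.
have rho01 : rho (t0, x0) < rho1.
  by rewrite rp0 /rho1 ltr_pXn2r ?nnegrE -?lt0n//; rewrite /t1; lra.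
have Kp0 : K (t0, x0).
  split; last exact: ltW.
  by rewrite /= /t1; apply/andP; split; lra.
have NV : usc_on (cylinderT T) (fun p => - V p).
  move=> p Tp a; rewrite ltrNl => h.
  by have := lV p Tp _ h; apply: filterS => q hq; rewrite ltrNl.
have uUK := usc_on_usc_in KT uU; have uVK := usc_on_usc_in KT NV.
have [pm Kpm hpm] := usc_in_max cK (ex_intro K _ Kp0) (usc_in_add uUK uVK).
set C := U pm + - V pm in hpm.
have C0 : 0 < C by have := hpm _ Kp0; move: VU; lra.
set th := U (t0, x0) - V (t0, x0); have th0 : 0 < th by rewrite subr_gt0.
have [|||n n0 hn] := @exprn_small (rho (t0, x0) / rho1) (th / (2 * C)).
- rewrite rp0 divr_ge0//; last exact: ltW.
  by rewrite exprn_ge0//; lra.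
- by rewrite ltr_pdivrMr// mul1r.
- by rewrite divr_gt0// mulr_gt0.
pose c := C / rho1 ^+ n.
have c0 : 0 < c by rewrite divr_gt0// exprn_gt0.
pose h p := c * rho p ^+ n.
have h00 : h (t0, x0) <= th / 2.
  move: hn; rewrite expr_div_n /h /c => hn.
  have : C * (rho (t0, x0) ^+ n / rho1 ^+ n) <= C * (th / (2 * C)).
    by rewrite ler_wpM2l// ltW.
  have -> : C * (th / (2 * C)) = th / 2 by field; rewrite gt_eqF.
  by apply: le_trans; rewrite le_eqVlt; apply/orP; left; apply/eqP; ring.
have h1 p : rho p = rho1 -> h p = C.
  by move=> rE; rewrite /h rE /c divfK// gt_eqF// exprn_gt0.
have h0 p : K p -> 0 <= h p.
  move=> [/andP[_ pT] _]; rewrite mulr_ge0 ?(ltW c0)// exprn_ge0//.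
  by rewrite (le_trans _ (cone_ge1 _ _ pT)).
pose G : set (R * 'rV[R]_N) := [set p | [/\ t1 < p.1, p.1 < T & rho p < rho1]].
have GK p : G p -> K p by move=> [p1 pT pr]; split; [rewrite !ltW|exact: ltW].
have oG p : G p -> exists2 d : R, 0 < d & forall q, `|q - p| < d -> G q.
  move=> [p1 pT pr].
  set e := Num.min (p.1 - t1) (T - p.1).
  have e0 : 0 < e by rewrite lt_min !subr_gt0 p1.
  have [e1 e2] : e <= p.1 - t1 /\ e <= T - p.1 by rewrite !ge_min !lexx orbT.
  have k0 : 0 < rho1 - rho p by rewrite subr_gt0.
  have /cvgrPdist_lt/(_ _ k0)/nbhs_normP[d /= d0 hd] := crho p.
  exists (Num.min e d); first by rewrite lt_min e0.
  clearbody e; move=> q; rewrite lt_min => /andP[qe qd].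
  have : `|q.1 - p.1| < e.
    by apply: le_lt_trans qe; rewrite [leRHS]/Num.norm /= le_max lexx.
  have : ball_ Num.norm p d q by rewrite /ball_ /= distrC.
  move=> /hd /=; rewrite !ltr_norml => /andP[r1 _] /andP[r2 r3].
  by split; lra.
have uf : usc_in K (fun p => U p + - h p).
  apply: usc_in_add => //; apply: usc_in_continuous.
  move=> p; apply: continuousN; apply: poly_fun_continuous.
  by apply: poly_mul; [exact: poly_cst|apply: poly_fun_exp; exact: poly_fun_cone].
have pos : 0 < U (t0, x0) + - h (t0, x0) + - V (t0, x0).
  by move: h00 th0; rewrite /th; lra.
have bad p : K p -> ~ G p -> U p + - h p + - V p <= 0.
  move=> Kp nG; have [/andP[p1 pT] pr] := Kp.
  have := hpm _ Kp; have := h0 _ Kp.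
  have [pT'|pT'] := leP T p.1.
    have -> : p = (T, p.2).
      by rewrite [LHS]surjective_pairing; congr pair; apply/le_anti; rewrite pT.
    by have := UV p.2; lra.
  have [pr'|pr'] := leP rho1 (rho p).
    by rewrite h1; [lra|apply/le_anti; rewrite pr].
  exfalso; apply: nG; split=> //.
  rewrite lt_neqAle p1 andbT; apply/eqP => p1E.
  move: pr'; rewrite ltNge => /negP; apply.
  rewrite /rho /cone -p1E ler_peMl//; first exact: ltW.
  by rewrite lerDl dotxx_ge0.
have cn0 : 0 < c * n%:R by rewrite mulr_gt0// ltr0n.
have L4 : 0 < 4 * L by rewrite mulr_gt0.
have k0 : 0 < c * n%:R / (4 * L) by rewrite divr_gt0.
have [a [p [q [a0 [Kp Gp] [Kq Gq] apq hmax]]]] :=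
  doubling_of_variables cK uf uVK Kp0 pos bad oG k0.
have Kcyl z : G z -> cylinder T z.
  by move=> [z1 zT _]; rewrite /cylinder /= zT andbT (lt_trans t10).
have nearK z : G z -> \forall w \near z, K w.
  move=> /oG[d d0 hd]; apply/nbhs_normP; exists d => // w.
  by rewrite /ball_ /= distrC => /hd/GK.
have [C2U dtU gradU] := upper_test T x0 m0 a c n q p.
have [C2V dtV gradV] := lower_test T a p q.
have maxU : \forall z \near p, U z - (a * sqdist q z + c * rho z ^+ n) <=
    U p - (a * sqdist q p + c * rho p ^+ n).
  apply: filterS (nearK _ Gp) => z Kz; have := hmax z q Kz Kq.
  by rewrite (sqdistC z q) (sqdistC p q) -/(h z) -/(h p); lra.
have minV : \forall z \near q, V q - - a * sqdist p q <= V z - - a * sqdist p z.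
  by apply: filterS (nearK _ Gq) => z Kz; have := hmax p z Kp Kz; lra.
have := supV _ C2V q (Kcyl _ Gq) minV; rewrite dtV gradV.
have := subU _ C2U p (Kcyl _ Gp) maxU; rewrite dtU gradU.
set P := c * n%:R * _ * _; set w := _ *: (p.2 - x0); set z := _ *: (p.2 - q.2).
move=> Hsub Hsup.
have [p1 pT pr] := Gp.
have PL : c * n%:R <= P.
  rewrite /P -mulrA ler_peMr ?(ltW cn0)//.
  rewrite -[leLHS]mulr1 ler_pM//.
    by rewrite exprn_ege1// cone_ge1// ltW.
  by rewrite exprn_ege1//; lra.
have P0 : 0 <= P := le_trans (ltW cn0) PL.
have p10 : 0 <= p.1 by rewrite ltW// (lt_trans t10).
have := barrier_strict A0 mA p10 (ltW pT) P0 (vA p.2); rewrite -/w => HB.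
(* the penalty terms differ by at most L |x - y| * 2 a |x - y| *)
have Hv : (v p.2 - v q.2) * enorm z <= 2 * L * (a * sqdist p q).
  rewrite /z enormZ ger0_norm ?mulr_ge0 ?(ltW a0)//.
  set r := enorm (p.2 - q.2); have r0 : 0 <= r := enorm_ge0 _.
  have vr : v p.2 - v q.2 <= L * r.
    apply: le_trans (ler_norm _) _; apply: le_trans (vL _ _) _.
    by rewrite ler_wpM2l ?normr_le_enorm// ltW.
  have h2 : (v p.2 - v q.2) * (2 * a * r) <= L * r * (2 * a * r).
    by rewrite ler_wpM2r// !mulr_ge0// ltW.
  have rs : r ^+ 2 <= sqdist p q.
    by rewrite /r enorm_distC sqr_enorm lerDr sqr_ge0.
  have h3 : (2 * L * a) * r ^+ 2 <= (2 * L * a) * sqdist p q.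
    by rewrite ler_wpM2l// !mulr_ge0// ltW.
  by apply: (le_trans h2); move: h3; lra.
have e1 := ler_enormD z w; have e2 := ler_enormD (z + w) (- w).
rewrite addrK enormN in e2.
have Hw : v p.2 * (enorm (z + w) - enorm z) <= `|v p.2| * enorm w.
  apply: le_trans (ler_norm _) _; rewrite normrM ler_wpM2l//.
  by rewrite ler_norml; lra.
have kE : c * n%:R / (4 * L) * (4 * L) = c * n%:R.
  by rewrite divfK// gt_eqF// mulr_gt0.
have Lk : L * (a * sqdist p q) <= L * (c * n%:R / (4 * L)).
  by rewrite ler_wpM2l// ltW.
move: Hsup Hsub HB PL cn0 kE Lk Hv Hw; lra.
Qed.

End Comparison.

(** * Convergence *)

Section Conclusion.
Context {R : realType} {N : nat}.

Lemma supersolution_eq (T : R) v (u w : R * 'rV[R]_N -> R) :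
  (forall p, cylinder T p -> u p = w p) ->
  supersolution T v u -> supersolution T v w.
Proof.
move=> uw [lu su]; split=> [p Tp a|phi C2 p Tp pmin].
  rewrite -(uw _ Tp) => h; have := lu p Tp _ h.
  move=> {}h; suff : \forall q \near p, cylinder T q -> a < w q by [].
  have {}h : \forall q \near p, cylinder T q -> a < u q by exact: h.
  by apply: filterS h => q hq Tq; rewrite -uw//; exact: hq.
apply: (su _ C2 p Tp); near=> q.
have Tq : cylinder T q by near: q; exact: nbhs_cylinder.
by rewrite !uw//; near: q.
Unshelve. all: by end_near.
Qed.

Lemma lipschitz_constant (f : 'rV[R]_N -> R) : lipschitz f ->
  exists2 L : R, 0 < L & forall x y, `|f x - f y| <= L * `|x - y|.
Proof.
move=> /pinfty_ex_gt0[L L0 hL]; exists L => // x y.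
exact: (hL (x, y)).
Qed.

End Conclusion.

Theorem theorem2 (R : realType) (N : nat) (T : R) (v uT : 'rV[R]_N -> R)
    (hT : 0 < T) (hv : lipschitz v)
    (huT_bounded : [bounded uT x | x in setT]) (huT : lipschitz uT)
    (ueps : R -> R * 'rV[R]_N -> R)
    (hueps : forall e, 0 < e -> is_game_value T v uT e (ueps e)) :
  exists u : R * 'rV[R]_N -> R,
    [/\ viscosity_solution T v uT u,
        (forall w, viscosity_solution T v uT w ->
           forall p, cylinderT T p -> w p = u p)
      & forall K : set (R * 'rV[R]_N), compact K -> K `<=` cylinderT T ->
          forall eta : R, 0 < eta ->
            \forall e \near 0^'+, forall p, K p -> `|ueps e p - u p| < eta].
Proof.
have [L L0 vL] := lipschitz_constant hv.
have [Lu Lu0 uTL] := lipschitz_constant huT.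
have [M M0 hM] := pinfty_ex_gt0 huT_bounded.
have uTM x : `|uT x| <= M by exact: hM.
pose U := upper_limit T ueps; pose V := lower_limit T ueps.
have usU : usc_on (cylinderT T) U := upper_limit_usc uTM hueps.
have lsV : lsc_on (cylinderT T) V := lower_limit_lsc uTM hueps.
have subU : subsolution T v U := upper_limit_subsolution L0 vL uTM hueps.
have supV : supersolution T v V := lower_limit_supersolution L0 vL uTM hueps.
have UT x : U (T, x) <= uT x := upper_limit_terminal L0 Lu0 vL uTL uTM hueps x hT.
have VT x : uT x <= V (T, x) := lower_limit_terminal L0 Lu0 vL uTL uTM hueps x hT.
have UV p : cylinderT T p -> U p = V p.
  move=> Tp; apply/le_anti/andP; split; last exact: lower_le_upper uTM hueps _ Tp.
  by apply: (comparison hT L0 vL) => // x; exact: le_trans (UT x) (VT x).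
have lsU : lsc_on (cylinderT T) U.
  move=> p Tp a; rewrite UV// => h.
  have {}h : \forall q \near p, cylinderT T q -> a < V q by exact: lsV.
  suff : \forall q \near p, cylinderT T q -> a < U q by [].
  by apply: filterS h => q hq Tq; rewrite UV//; exact: hq.
have cU : {within cylinderT T, continuous U}.
  by apply/within_continuous_usc_lsc.
have supU : supersolution T v U.
  by apply: supersolution_eq supV => p /cylinderW Tp; rewrite UV.
have UTE x : U (T, x) = uT x.
  by apply/le_anti; rewrite UT UV ?VT//; exact: cylinderT_terminal.
exists U; split=> //.
- move=> w [subw supw /within_continuous_usc_lsc[usw lsw] wT] p Tp.
  by apply/le_anti/andP; split; apply: (comparison hT L0 vL) => // x;
    rewrite wT UTE.
- move=> K cK KT eta eta0.
  apply: (uniform_convergence uTM hueps cU _ _ cK KT eta0) => // p Tp.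
  by rewrite -/V -UV.
Qed.
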